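(* Let $\mathfrak a=(A,\mathrm F,d,\star,1)$ be a complete left-unital differential graded pre-Lie algebra over a field $\mathbf k$ of characteristic $0$. Then $$\mathfrak G:=\big(1+\mathrm F_1A_0,\ \circledcirc,\ 1\big)$$ is a complete group, and the pre-Lie exponential map $\lambda\mapsto e^{\lambda}$ is a filtered isomorphism of groups, and therefore a homeomorphism, between the gauge group $\Gamma=(\mathrm F_1A_0,\mathrm{BCH},0)$ and $\mathfrak G$.
   Context: A filtered module is a module $A$ with a decreasing filtration by submodules $A=\mathrm F_0A\supset \mathrm F_1A\supset \mathrm F_2A\supset\cdots$; it is complete if the canonical map $A\to\lim_k A/\mathrm F_kA$ is an isomorphism. For (homologically) graded modules these notions are applied degreewise. The filtration defines a topology with the $x+\mathrm F_kA$ as basis of open sets. A complete dg pre-Lie algebra $(A,\mathrm F,d,\star)$ is a complete dg module $A$ ($d$ of degree $-1$, filtration preserving) with a degree $0$ bilinear product with $\mathrm F_iA\star \mathrm F_jA\subset \mathrm F_{i+j}A$, with right-symmetric associator $(a\star b)\star c-a\star(b\star c)=(-1)^{|b||c|}\big((a\star c)\star b-a\star(c\star b)\big)$, such that $d$ is a derivation of $\star$. It is left-unital if it has an element $1\in \mathrm F_0A_0$ with $d(1)=0$ and $1\star a=a$ for all $a$. Its Lie bracket is $[a,b]=a\star b-(-1)^{|a||b|}b\star a$. Gauge group: $\Gamma=(\mathrm F_1A_0,\mathrm{BCH},0)$, where $\mathrm{BCH}(x,y)=\ln(e^xe^y)=x+y+\frac12[x,y]+\cdots$ is the (convergent) Baker–Campbell–Hausdorff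 series, filtered by $\mathrm F_k\Gamma=\mathrm F_kA_0$, $k\ge1$. The set $1+\mathrm F_1A_0$ is filtered by the subsets $1+\mathrm F_kA_0$, $k\ge 1$. Pre-Lie exponential: for $\lambda\in \mathrm F_1A_0$, $e^\lambda:=1+\lambda+\frac{\lambda^{\star2}}{2!}+\frac{\lambda^{\star3}}{3!}+\cdots$ where $\lambda^{\star n}=(\cdots((\lambda\star\lambda)\star\lambda)\cdots)\star\lambda$ ($n$ factors). Symmetric braces: $\{a;\}=a$ and $\{a;b_1,\dots,b_n\}=\{\{a;b_1,\dots,b_{n-1}\};b_n\}-\sum_{i=1}^{n-1}(-1)^{|b_n|(|b_{i+1}|+\cdots+|b_{n-1}|)}\{a;b_1,\dots,b_{i-1},\{b_i;b_n\},b_{i+1},\dots,b_{n-1}\}$, with $\{a;b\}=a\star b$. Circle product: for $a\in A$, $b\in \mathrm F_1A_0$, $a\circledcirc(1+b):=\sum_{n\ge0}\frac1{n!}\{a;\underbrace{b,\dots,b}_n\}$ (convergent). A filtered group is a group $G$ with a decreasing filtration by subgroups $G=\mathrm F_1G\supset \mathrm F_2G\supset\cdots$ such that $xyx^{-1}y^{-1}\in \mathrm F_{i+j}G$ for $x\in \mathrm F_iG$, $y\in \mathrm F_jG$; it is complete if the associated topology is Hausdorff and complete. A filtered isomorphism is a group isomorphism which, together with its inverse, preserves the filtrations. *)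

(* Defs.v *)
From HB Require Import structures.
From mathcomp Require Import all_boot all_order all_algebra.
From mathcomp Require Import boolp classical_sets topology.

Set Implicit Arguments.
Unset Strict Implicit.
Unset Printing Implicit Defensive.

Import GRing.Theory.
Local Open Scope classical_set_scope.
Local Open Scope ring_scope.

Section FilteredModule.
Variables (K : fieldType) (V : lmodType K).
Implicit Type F : nat -> set V.

Record filtration F : Prop := Filtration {
  fil_full : F 0%N = setT;
  fil_decr : forall k, F k.+1 `<=` F k;
  fil_zero : forall k, F k 0;
  fil_lin : forall k (c : K) x y, F k x -> F k y -> F k (c *: x + y) }.

(* The class of x in V / F k, as a subset of V. *)
Definition fcoset F k (x : V) : set V := [set y | F k (y - x)].

(* The inverse limit of the V / F k; the transition map V / F k.+1 -> V / F k
   sends a class to the class that contains it. *)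
Definition flim F : set (nat -> set V) :=
  [set c | (forall k, exists x, c k = fcoset F k x) /\
           (forall k, c k.+1 `<=` c k)].

(* The canonical map V -> lim_k V / F k is bijective. *)
Definition fcomplete F : Prop :=
  forall c, flim F c -> exists! x, (fun k => fcoset F k x) = c.

Definition fconverges F (s : nat -> V) : set V :=
  [set x | forall k, \forall n \near \oo, F k (s n - x)].

Definition fsum F (u : nat -> V) : V :=
  xget 0 (fconverges F (fun n => \sum_(i < n) u i)).

Lemma filB F k x y : filtration F -> F k x -> F k y -> F k (x - y).
Proof. by move=> fF Fx Fy; rewrite addrC -scaleN1r; apply: fil_lin. Qed.

Lemma filD F k x y : filtration F -> F k x -> F k y -> F k (x + y).
Proof. by move=> fF Fx Fy; rewrite -[x]scale1r; apply: fil_lin. Qed.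

Lemma filZ F k (c : K) x : filtration F -> F k x -> F k (c *: x).
Proof.
by move=> fF Fx; rewrite -[_ *: _]addr0; apply: fil_lin => //; apply: fil_zero.
Qed.

Lemma fil_sum F k (I : Type) (r : seq I) (P : pred I) (u : I -> V) :
  filtration F -> (forall i, P i -> F k (u i)) -> F k (\sum_(i <- r | P i) u i).
Proof.
move=> fF Fu; apply: big_ind => //; first exact: fil_zero.
by move=> x y; apply: filD.
Qed.

Lemma fil_le F m n : filtration F -> (m <= n)%N -> F n `<=` F m.
Proof.
move=> fF /subnK <-; elim: (n - m)%N => // p IH x.
by rewrite addSn => /(fil_decr fF)/IH.
Qed.

Lemma fsumP F u : filtration F -> fcomplete F -> (forall n, F n (u n)) ->
  fconverges F (fun n => \sum_(i < n) u i) (fsum F u).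
Proof.
move=> fF cF Fu; rewrite /fsum; set s := fun n => _; apply: xgetPex.
have sP k n : (k <= n)%N -> F k (s n - s k).
  move=> /subnK <-; elim: (n - k)%N => [|p IH]; first by rewrite subrr; apply: fil_zero.
  rewrite addSn /s big_ord_recr /= addrAC; apply: filD => //.
  exact: (fil_le fF (leq_addl p k)) (Fu _).
have [|x [xP _]] := cF (fun k => fcoset F k (s k)).
  split=> [j|j y]; first by exists (s j).
  rewrite /fcoset /= => Fy; rewrite -[y](subrK (s j.+1)) -addrA.
  by apply: filD => //; [apply: fil_decr|apply: sP].
exists x => k; exists k => // n /= kn.
rewrite -[s n](subrK (s k)) -addrA; apply: filD => //; first exact: sP.
have : fcoset F k (s k) (s k) by rewrite /fcoset /= subrr; apply: fil_zero.
by rewrite -(congr1 (@^~ k) xP).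
Qed.

Lemma fil_fsum F k u z : filtration F -> fcomplete F -> (forall n, F n (u n)) ->
  (\forall n \near \oo, F k (\sum_(i < n) u i - z)) -> F k (fsum F u - z).
Proof.
move=> fF cF Fu [N _ NP]; have [M _ MP] := fsumP fF cF Fu k.
have := filB fF (NP _ (leq_maxl N M)) (MP _ (leq_maxr N M)).
by rewrite opprB addrC addrA subrK.
Qed.

End FilteredModule.

Section Homogeneous.
Variables (K : fieldType) (A : int -> lmodType K).

Definition hom : Type := {i : int & A i}.
Definition Hom i (a : A i) : hom := Tagged A a.
Definition deg (x : hom) : int := tag x.

(* The component of degree m of a homogeneous element: [in_deg m (Hom a)] is
   [a] transported along deg (Hom a) = m when the degrees agree, and 0
   otherwise. It is only used below where the degrees agree provably, but not
   by conversion. *)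
Definition in_deg m (x : hom) : A m := untag 0 (fun a : A m => a) x.

Variable star : forall i j, A i -> A j -> A (i + j).

Definition hstar (x y : hom) : hom := Hom (star (tagged x) (tagged y)).

(* [hbrace n a b] is {a; b 0, ..., b n.-1}. *)
Fixpoint hbrace n (a : hom) (b : nat -> hom) : hom :=
  if n is p.+1 then
    let m := deg a + \sum_(i < n) deg (b i) in
    Hom (in_deg m (hstar (hbrace p a b) (b p))
      - \sum_(i < p) (-1 : K) ^ (deg (b p) * \sum_(i.+1 <= j < p) deg (b j)) *:
          in_deg m (hbrace p a
            (fun j => if j == i then hstar (b i) (b p) else b j)))
  else a.

Definition hlie (x y : hom) : hom :=
  Hom (star (tagged x) (tagged y)
       - (-1 : K) ^ (deg x * deg y) *: in_deg (deg x + deg y) (hstar y x)).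

Lemma in_degE i (a : A i) : in_deg i (Hom a) = a.
Proof. by rewrite /in_deg /untag; case: eqP => // e; rewrite /etagged eq_axiomK. Qed.

Lemma in_deg_ind (P : forall i, set (A i)) m x :
  (forall i, P i 0) -> P _ (tagged x) -> P m (in_deg m x).
Proof.
case: x => i a P0 Pa; rewrite /in_deg.
have [e|ne] := eqVneq i m; last by rewrite untag_dflt.
by subst m; rewrite -/(in_deg i (Hom a)) in_degE.
Qed.

End Homogeneous.

Record complete_dg_prelie (K : fieldType) := CompleteDGPreLie {
  gmod :> int -> lmodType K;
  F : nat -> forall i, set (gmod i);
  d : forall i, {linear gmod i -> gmod (i - 1)};
  star : forall i j, gmod i -> gmod j -> gmod (i + j);

  F_filtration : forall i, filtration (fun k => @F k i);
  F_complete : forall i, fcomplete (fun k => @F k i);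

  d_fil : forall k i (a : gmod i), F k a -> F k (d i a);
  d_square : forall i (a : gmod i), d (i - 1) (d i a) = 0;

  star_linl : forall i j (b : gmod j), linear (fun a : gmod i => star a b);
  star_linr : forall i j (a : gmod i), linear (fun b : gmod j => star a b);
  star_fil : forall k l i j (a : gmod i) (b : gmod j),
    F k a -> F l b -> F (k + l)%N (star a b);

  star_d : forall i j (a : gmod i) (b : gmod j),
    d (i + j) (star a b)
    = in_deg (i + j - 1) (Hom (star (d i a) b))
      + (-1 : K) ^ i *: in_deg (i + j - 1) (Hom (star a (d j b)));

  star_prelie : forall a b c : hom gmod,
    let m := deg a + deg b + deg c in
    let mul := hstar star in
    in_deg m (mul (mul a b) c) - in_deg m (mul a (mul b c))
    = (-1 : K) ^ (deg b * deg c) *: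
        (in_deg m (mul (mul a c) b) - in_deg m (mul a (mul c b))) }.

Arguments F_complete {K} c i _ _ : rename.

Record complete_unital_dg_prelie (K : fieldType) := CompleteUnitalDGPreLie {
  prelie :> complete_dg_prelie K;
  one : prelie 0;
  d_one : d prelie 0 one = 0;
  one_star : forall i (a : prelie i), in_deg i (Hom (star one a)) = a }.

Section BCH.
Variable K : fieldType.

(* Formal power series in two noncommuting variables X and Y, as families of
   coefficients indexed by words; the letters X and Y are false and true. *)
Definition ncseries : Type := seq bool -> K.

Definition nc_one : ncseries := fun w => (w == [::])%:R.
Definition nc_var (b : bool) : ncseries := fun w => (w == [:: b])%:R.
Definition nc_sub (f g : ncseries) : ncseries := fun w => f w - g w.
Definition nc_mul (f g : ncseries) : ncseries :=
  fun w => \sum_(i < (size w).+1) f (take i w) * g (drop i w).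
Definition nc_pow (f : ncseries) n : ncseries := iter n (nc_mul f) nc_one.

(* exp f for f without constant term, and ln f for f with constant term 1: the
   coefficient of w only involves the powers up to size w. *)
Definition nc_exp (f : ncseries) : ncseries :=
  fun w => \sum_(0 <= n < (size w).+1) (n`!%:R)^-1 * nc_pow f n w.
Definition nc_ln (f : ncseries) : ncseries :=
  fun w => \sum_(1 <= n < (size w).+1)
    (-1) ^+ n.-1 / n%:R * nc_pow (nc_sub f nc_one) n w.

Definition bch_series : ncseries :=
  nc_ln (nc_mul (nc_exp (nc_var false)) (nc_exp (nc_var true))).

Inductive lie_monomial :=
  | LieVar of bool
  | LieBr of lie_monomial & lie_monomial.

Fixpoint lie_deg (t : lie_monomial) : nat :=
  match t with LieVar _ => 1%N | LieBr s t => (lie_deg s + lie_deg t)%N end.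

Fixpoint lie_expand (t : lie_monomial) : ncseries :=
  match t with
  | LieVar b => nc_var b
  | LieBr s t => nc_sub (nc_mul (lie_expand s) (lie_expand t))
                        (nc_mul (lie_expand t) (lie_expand s))
  end.

Fixpoint lie_eval (V : Type) (br : V -> V -> V) (x y : V) (t : lie_monomial) : V :=
  match t with
  | LieVar b => if b then y else x
  | LieBr s t => br (lie_eval br x y s) (lie_eval br x y t)
  end.

(* The homogeneous part of degree n of ln (e^X e^Y) is a Lie polynomial (in
   characteristic 0); [bch_part n] is the value of this polynomial at x and y.
   It does not depend on the expression p of this polynomial by brackets, since
   the free Lie algebra embeds in the free associative algebra. *)
Definition bch_part (V : lmodType K) (br : V -> V -> V) (n : nat) (x y : V) : V :=
  xget 0 [set z | exists p : seq (K * lie_monomial),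
    [/\ all (fun ct => lie_deg ct.2 == n) p,
        forall w, size w = n ->
          \sum_(ct <- p) ct.1 * lie_expand ct.2 w = bch_series w
      & z = \sum_(ct <- p) ct.1 *: lie_eval br x y ct.2]].

End BCH.

Section Operations.
Variables (K : fieldType) (A : complete_unital_dg_prelie K).

Definition star0 (a b : A 0) : A 0 := in_deg 0 (Hom (star a b)).
Definition lie0 (a b : A 0) : A 0 := in_deg 0 (hlie (@star K A) (Hom a) (Hom b)).

(* [lpow l n] is the left-normed power of l with n.+1 factors. *)
Definition lpow (l : A 0) n : A 0 := iter n (fun a => star0 a l) l.

Definition prelie_exp (l : A 0) : A 0 :=
  one A + fsum (fun k => @F K A k 0) (fun n => (n.+1`!%:R)^-1 *: lpow l n).

(* [brace_pow a b n] is {a; b, ..., b}, with n copies of b. *)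
Definition brace_pow i (a : A i) (b : A 0) n : A i :=
  in_deg i (hbrace (@star K A) n (Hom a) (fun=> Hom b)).

(* [circ a b] is a (o) (1 + b), where (o) is the circle product. *)
Definition circ i (a : A i) (b : A 0) : A i :=
  fsum (fun k => @F K A k i) (fun n => (n`!%:R)^-1 *: brace_pow a b n).

Definition bch (x y : A 0) : A 0 :=
  fsum (fun k => @F K A k 0) (fun n => bch_part lie0 n.+1 x y).

(* The series defining these operations converge, with limits in F_1 A_0 and
   1 + F_1 A_0. *)

Let fA i := F_filtration A i.

Lemma fil_in_deg k m (x : hom A) : F k (tagged x) -> F k (in_deg m x).
Proof.
apply: (@in_deg_ind K A (fun i => @F K A k i)) => i.
exact: (fil_zero (fA i)).
Qed.

Lemma fil_star0 k l (a b : A 0) : F k a -> F l b -> F (k + l)%N (star0 a b).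
Proof. by move=> Fa Fb; apply: fil_in_deg; apply: star_fil. Qed.

Lemma fil_lie0 k l (a b : A 0) : F k a -> F l b -> F (k + l)%N (lie0 a b).
Proof.
move=> Fa Fb; apply: fil_in_deg => /=; apply: (filB (fA _)).
  exact: star_fil.
apply: (filZ _ (fA _)); apply: fil_in_deg.
by rewrite addnC; apply: star_fil.
Qed.

Lemma fil_hbrace n k (f : nat -> nat) (a : hom A) (b : nat -> hom A) :
  F k (tagged a) -> (forall i, F (f i) (tagged (b i))) ->
  F (k + \sum_(i < n) f i)%N (tagged (hbrace (@star K A) n a b)).
Proof.
move=> Fa; elim: n f b => [|n IH] f b Fb; first by rewrite big_ord0 addn0.
rewrite big_ord_recr /=; apply: (filB (fA _)).
  by apply: fil_in_deg; rewrite addnA; apply: star_fil => //; apply: IH.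
apply: (fil_sum _ (fA _)) => i _.
apply: (filZ _ (fA _)); apply: fil_in_deg.
set b' := fun j => _; pose f' j := (f j + (j == i) * f n)%N.
have -> : (\sum_(j < n) f j + f n = \sum_(j < n) f' j)%N.
  rewrite big_split /=; congr addn.
  rewrite (bigD1 i) //= eqxx mul1n big1 ?addn0 // => j.
  by rewrite -val_eqE => /negPf ->.
apply: IH => j; rewrite /b' /f'; case: eqP => [->|_]; last by rewrite addn0.
by rewrite mul1n; apply: star_fil.
Qed.

Lemma fil_brace_pow i k (a : A i) (b : A 0) n :
  F k a -> F 1%N b -> F (k + n)%N (brace_pow a b n).
Proof.
move=> Fa Fb; apply: fil_in_deg.
have -> : (k + n = k + \sum_(i < n) 1)%N by rewrite sum1_card card_ord.
exact: (@fil_hbrace n k (fun=> 1%N)).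
Qed.

Lemma circ_cvg i (a : A i) (b : A 0) : F 1%N b ->
  fconverges (fun k => @F K A k i)
    (fun n => \sum_(j < n) (j`!%:R)^-1 *: brace_pow a b j) (circ a b).
Proof.
move=> Fb; refine (fsumP (fA i) (F_complete A i) _) => n.
apply: (filZ _ (fA i)); rewrite -[n]add0n; apply: fil_brace_pow => //.
by rewrite (fil_full (fA i)).
Qed.

Lemma fil_lpow (l : A 0) n : F 1%N l -> F n.+1 (lpow l n).
Proof.
by move=> Fl; elim: n => //= n IH; rewrite -addn1; apply: fil_star0.
Qed.

Lemma prelie_exp_cvg (l : A 0) : F 1%N l ->
  fconverges (fun k => @F K A k 0)
    (fun n => one A + \sum_(j < n) (j.+1`!%:R)^-1 *: lpow l j) (prelie_exp l).
Proof.
move=> Fl k; pose u n := (n.+1`!%:R : K)^-1 *: lpow l n.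
have Fu n : F n (u n).
  by apply: (filZ _ (fA 0)); apply: (fil_decr (fA 0)); apply: fil_lpow.
have [N _ NP] := fsumP (fA 0) (F_complete A 0) Fu k.
by exists N => // n /NP /=; rewrite opprD addrACA subrr add0r.
Qed.

Lemma fil_lie_eval (x y : A 0) t : F 1%N x -> F 1%N y ->
  F (lie_deg t) (lie_eval lie0 x y t).
Proof.
by move=> Fx Fy; elim: t => [[]|s IHs t IHt] //=; apply: fil_lie0.
Qed.

Lemma fil_bch_part n (x y : A 0) : F 1%N x -> F 1%N y ->
  F n (bch_part lie0 n x y).
Proof.
move=> Fx Fy; rewrite /bch_part; case: xgetP => [z _|_]; last exact: (fil_zero (fA 0)).
case=> p [pn _ ->]; elim: p pn => [|ct p IH] /= => [_|/andP[/eqP ctn pn]].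
  by rewrite big_nil; apply: (fil_zero (fA 0)).
rewrite big_cons; apply: (filD (fA 0)); last exact: IH.
by apply: (filZ _ (fA 0)); rewrite -[n]ctn; apply: fil_lie_eval.
Qed.

Lemma bch_cvg (x y : A 0) : F 1%N x -> F 1%N y ->
  fconverges (fun k => @F K A k 0)
    (fun n => \sum_(j < n) bch_part lie0 j.+1 x y) (bch x y).
Proof.
move=> Fx Fy; refine (fsumP (fA 0) (F_complete A 0) _) => n.
by apply: (fil_decr (fA 0)); apply: fil_bch_part.
Qed.

Lemma fil_bch (x y : A 0) : F 1%N x -> F 1%N y -> F 1%N (bch x y).
Proof.
move=> Fx Fy; rewrite -[bch x y]subr0.
apply: (fil_fsum (fA 0) (F_complete A 0)) => [n|].
  by apply: (fil_decr (fA 0)); apply: fil_bch_part.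
exists 0%N => // n _; rewrite /= subr0; apply: (fil_sum _ (fA 0)) => i _.
exact: (fil_le (fA 0) (ltn0Sn i)) (fil_bch_part _ Fx Fy).
Qed.

Lemma fil_prelie_exp (l : A 0) : F 1%N l -> F 1%N (prelie_exp l - one A).
Proof.
move=> Fl; rewrite /prelie_exp addrAC subrr add0r -[fsum _ _]subr0.
have Fu n : F n.+1 ((n.+1`!%:R : K)^-1 *: lpow l n).
  by apply: (filZ _ (fA 0)); apply: fil_lpow.
apply: (fil_fsum (fA 0) (F_complete A 0)) => [n|].
  exact: (fil_decr (fA 0)).
exists 0%N => // n _; rewrite /= subr0; apply: (fil_sum _ (fA 0)) => i _.
exact: (fil_le (fA 0) (ltn0Sn i)) (Fu _).
Qed.

Lemma fil_circ (a b : A 0) :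
  F 1%N (a - one A) -> F 1%N b -> F 1%N (circ a b - one A).
Proof.
move=> Fa Fb; have Fu n : F n ((n`!%:R : K)^-1 *: brace_pow a b n).
  apply: (filZ _ (fA 0)); rewrite -[n in F n _]add0n; apply: fil_brace_pow => //.
  by rewrite (fil_full (fA 0)).
apply: (fil_fsum (fA 0) (F_complete A 0)) => //.
exists 1%N => // -[//|n] _ /=; rewrite big_ord_recl /= addrAC.
apply: (filD (fA 0)).
  by rewrite fact0 invr1 scale1r /brace_pow /= in_degE.
apply: (fil_sum _ (fA 0)) => i _.
exact: (fil_le (fA 0) (ltn0Sn i)) (Fu _).
Qed.

End Operations.

(* The data underlying a filtered group; only the [gfil k] with k > 0 are
   meaningful. *)
Record filtered_magma := FilteredMagma {
  carrier :> Type;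
  gmul : carrier -> carrier -> carrier;
  gunit : carrier;
  gfil : nat -> set carrier }.

Record filtered_group_laws (G : filtered_magma) (inv : G -> G) : Prop :=
  FilteredGroupLaws {
    g_assoc : associative (@gmul G);
    g_unitl : left_id (@gunit G) (@gmul G);
    g_unitr : right_id (@gunit G) (@gmul G);
    g_invl : left_inverse (@gunit G) inv (@gmul G);
    g_invr : right_inverse (@gunit G) inv (@gmul G);
    gfil_full : @gfil G 1%N = setT;
    gfil_decr : forall k, (0 < k)%N -> @gfil G k.+1 `<=` @gfil G k;
    gfil_unit : forall k, (0 < k)%N -> gfil k (@gunit G);
    gfil_mul : forall k, (0 < k)%N -> forall x y : G,
      gfil k x -> gfil k y -> gfil k (gmul x y);
    gfil_inv : forall k, (0 < k)%N -> forall x : G, gfil k x -> gfil k (inv x);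
    gfil_comm : forall i j, (0 < i)%N -> (0 < j)%N -> forall x y : G,
      gfil i x -> gfil j y ->
      gfil (i + j)%N (gmul (gmul (gmul x y) (inv x)) (inv y)) }.

Definition filtered_group (G : filtered_magma) : Prop :=
  exists inv : G -> G, filtered_group_laws inv.

Definition gcoset (G : filtered_magma) (x : G) k : set G :=
  [set gmul x h | h in gfil k].

(* The topology of a filtered group. The cosets x F_k form a subbase; when G is
   a filtered group they form a base, two of them being disjoint or nested. *)
Definition topo (G : filtered_magma) : Type := carrier G.
HB.instance Definition _ G := gen_eqMixin (topo G).
HB.instance Definition _ G := gen_choiceMixin (topo G).
HB.instance Definition _ G := isSubBaseTopological.Build (topo G)
  [set U : set (topo G) | exists x k, (0 < k)%N /\ U = @gcoset G x k] id.

(* Every Cauchy filter (for the uniform structure of G) converges. *)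
Definition cauchy_complete (G : filtered_magma) : Prop :=
  forall Phi : set_system (topo G), ProperFilter Phi ->
    (forall k, (0 < k)%N -> exists x : G, Phi (gcoset x k)) ->
    exists x : topo G, Phi --> x.

Definition complete_group (G : filtered_magma) : Prop :=
  [/\ filtered_group G, hausdorff_space (topo G) & cauchy_complete G].

Definition filtered_iso (G H : filtered_magma) (f : G -> H) : Prop :=
  [/\ filtered_group G, filtered_group H,
      {morph f : x y / gmul x y >-> gmul x y}
    & exists g : H -> G,
      [/\ cancel f g, cancel g f,
          forall k x, (0 < k)%N -> gfil k x -> gfil k (f x)
        & forall k y, (0 < k)%N -> gfil k y -> gfil k (g y)]].

Definition homeomorphism (S T : topologicalType) (f : S -> T) : Prop :=
  exists g : T -> S, [/\ cancel f g, cancel g f, continuous f & continuous g].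

Section Groups.
Variables (K : fieldType) (A : complete_unital_dg_prelie K).

Definition F1A0 : Type := {x : A 0 | F 1%N x}.
Definition oneF1A0 : Type := {x : A 0 | F 1%N (x - one A)}.

Let F0 k : F k (0 : A 0). Proof. exact: (fil_zero (F_filtration A 0)). Qed.

Definition gauge_mul (x y : F1A0) : F1A0 :=
  exist _ (bch (sval x) (sval y)) (fil_bch (svalP x) (svalP y)).

Definition gauge_group : filtered_magma :=
  @FilteredMagma F1A0 gauge_mul (exist _ 0 (F0 1%N))
    (fun k => [set x | F k (sval x)]).

Definition circ_mul (x y : oneF1A0) : oneF1A0 :=
  exist _ (circ (sval x) (sval y - one A)) (fil_circ (svalP x) (svalP y)).

Let oneP : F 1%N (one A - one A). Proof. by rewrite subrr. Qed.

Definition circ_group : filtered_magma :=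
  @FilteredMagma oneF1A0 circ_mul (exist _ (one A) oneP)
    (fun k => [set x | F k (sval x - one A)]).

Definition exp_map (x : gauge_group) : circ_group :=
  exist _ (prelie_exp (sval x)) (fil_prelie_exp (svalP x)).

End Groups.

(* Main.v *)
From HB Require Import structures.
Require Import Defs.
From mathcomp Require Import all_boot all_order all_algebra.
From mathcomp Require Import finmap boolp classical_sets functions topology.

Set Implicit Arguments.
Unset Strict Implicit.
Unset Printing Implicit Defensive.

Import GRing.Theory.
Local Open Scope ring_scope.

(** Both groups are compared through right multiplications.  In degree 0 all
    signs disappear, and right symmetry of the associator says that
    R_x : a |-> a * x satisfies R_[x,y] = R_y R_x - R_x R_y, so that R is an
    anti-representation of the Lie algebra F_1 A_0.  It is faithful, as
    R_x(1) = x for a left unit 1, and the pre-Lie exponential is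
    e^x = exp(R_x)(1).

    The theorem rests on two identities of operators:
    - a o e^x = exp(R_x)(a) ([circ_rexp]), where o is the circle product;
    - exp(R_BCH(x,y)) = exp(R_y) exp(R_x) ([rexp_bch]).
    Together they give (a o e^x) o e^y = a o e^BCH(x,y), which for a = 1 is the
    multiplicativity of the exponential, and which yields associativity of o
    since each element of 1 + F_1 A_0 is an exponential.

    For the first identity, a is transported along the flow e^(tx): the formal
    series f(t) = a o e^(tx) satisfies f' = f * x and f(0) = a, because braces
    are symmetric and the derivative of b(t) = e^(tx) - 1 is x + b * x.  Formal
    series with coefficients in A_0 again form a pre-Lie ring, so the
    computation takes place in the braces of that ring.  Symmetry of the braces
    and their compatibility with d/dt both follow from one fact, that gl(V) acts
    on multilinear maps as a Lie algebra ([act_comm]).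

    For the second identity, noncommutative power series act on A_0, the letters
    X and Y acting by R_x and R_y.  One needs that the homogeneous parts of
    Z = ln(e^X e^Y) are Lie polynomials ([bch_part_lie]).  Applying the Euler
    derivation D to e^Z = e^X e^Y gives
      sum_k ad^k(D Z) / (k+1)! = Y + sum_k ad_Y^k(X) / k!,
    with ad(w) = [w,Z] and ad_Y(w) = [w,Y]; it determines each part of Z as a
    Lie polynomial in X, Y and parts of lower degree.  Since right multiplications are
    faithful, the value of a Lie polynomial at x and y is determined by its
    action, whatever expression by brackets is chosen.

    The exponential and the left factor of o depend on their argument through
    maps that are the identity up to terms of higher filtration; by completeness
    such maps are bijective ([unipotent_surj], [unipotent_fil]).  This makes the
    exponential a filtered bijection and provides inverses.  The topology of
    1 + F_1 A_0 is induced by that of A_0, as the two kinds of cosets agree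
    ([circ_gcoset]), so completeness is inherited from A_0; the gauge group gets
    its structure through the exponential. *)

(** * Symmetric braces in an ungraded pre-Lie ring *)

Definition upd (V : Type) (b : nat -> V) i x : nat -> V :=
  fun j => if j == i then x else b j.

Section Upd.
Variable V : Type.
Implicit Types (b : nat -> V) (x y : V).

Lemma upd_eq b i x : upd b i x i = x.
Proof. by rewrite /upd eqxx. Qed.

Lemma upd_neq b i j x : j != i -> upd b i x j = b j.
Proof. by rewrite /upd => /negPf ->. Qed.

Lemma upd_upd b i x y : upd (upd b i x) i y = upd b i y.
Proof. by apply/funext => j; rewrite /upd; case: eqP. Qed.

Lemma updC b i j x y : i != j -> upd (upd b i x) j y = upd (upd b j y) i x.
Proof.
move=> ij; apply/funext => k; rewrite /upd.
by case: (k =P j) => // ->; rewrite eq_sym (negPf ij).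
Qed.

End Upd.

Section MultiAdditive.
Variable V : zmodType.
Implicit Types (b : nat -> V) (M : (nat -> V) -> V) (phi psi theta : V -> V).

Definition additive_fun phi := forall x y, phi (x + y) = phi x + phi y.

Lemma additive_fun0 phi : additive_fun phi -> phi 0 = 0.
Proof. by move=> phiD; apply: (addrI (phi 0)); rewrite -phiD !addr0. Qed.

Lemma additive_funN phi x : additive_fun phi -> phi (- x) = - phi x.
Proof.
by move=> phiD; apply/eqP; rewrite -addr_eq0 -phiD addNr additive_fun0.
Qed.

Lemma additive_funB phi x y :
  additive_fun phi -> phi (x - y) = phi x - phi y.
Proof. by move=> phiD; rewrite phiD additive_funN. Qed.

Lemma additive_fun_sum phi (I : Type) (r : seq I) (P : pred I) (u : I -> V) :
  additive_fun phi ->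
  phi (\sum_(i <- r | P i) u i) = \sum_(i <- r | P i) phi (u i).
Proof. by move=> phiD; apply: (big_morph phi phiD); apply: additive_fun0. Qed.

Definition multiadditive n M := forall b i, (i < n)%N ->
  additive_fun (fun x => M (upd b i x)).

(** The representation of gl(V) on n-linear maps from V to V. Each brace is the
    action of a right multiplication on the preceding one ([braceS]). *)
Definition act n phi M : (nat -> V) -> V :=
  fun b => phi (M b) - \sum_(i < n) M (upd b i (phi (b i))).

Lemma act_upd n phi M b i x : (i < n)%N ->
  act n phi M (upd b i x) =
  phi (M (upd b i x)) - (M (upd b i (phi x))
    + \sum_(j < n | val j != i) M (upd (upd b j (phi (b j))) i x)).
Proof.
move=> lt_in; rewrite /act (bigD1 (Ordinal lt_in)) //= upd_eq upd_upd.
congr (_ - (_ + _)); apply: eq_bigr => j ji.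
by rewrite upd_neq // updC // eq_sym.
Qed.

Lemma act_multiadditive n phi M : additive_fun phi ->
  multiadditive n M -> multiadditive n (act n phi M).
Proof.
move=> phiD MD b i lt_in x y; rewrite !act_upd // phiD !MD // phiD.
under eq_bigr do rewrite MD //.
by rewrite big_split /= [X in _ - X]addrACA opprD addrACA.
Qed.

(** The action is a Lie action: the terms where the two endomorphisms hit
    different variables cancel. *)
Lemma act_comm n phi psi theta M b :
  additive_fun phi -> additive_fun psi -> multiadditive n M ->
  (forall x, phi (psi x) - psi (phi x) = theta x) ->
  act n phi (act n psi M) b - act n psi (act n phi M) b = act n theta M b.
Proof.
move=> phiD psiD MD E.
have actE f g : additive_fun f -> act n f (act n g M) b =
    (f (g (M b)) + \sum_(i < n) M (upd b i (g (f (b i))))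
     + \sum_(i < n) \sum_(j < n | j != i)
         M (upd (upd b j (g (b j))) i (f (b i))))
    - (\sum_(i < n) f (M (upd b i (g (b i))))
       + \sum_(i < n) g (M (upd b i (f (b i))))).
  move=> fD; rewrite [LHS]/act {1}/act additive_funB //.
  rewrite additive_fun_sum //; under [X in _ - _ - X]eq_bigr do rewrite act_upd //.
  by rewrite big_split /= sumrN big_split /= opprB addrACA -opprD addrA.
rewrite !actE //.
have -> : \sum_(i < n) \sum_(j < n | j != i)
            M (upd (upd b j (phi (b j))) i (psi (b i))) =
          \sum_(i < n) \sum_(j < n | j != i)
            M (upd (upd b j (psi (b j))) i (phi (b i))).
  rewrite (exchange_big_dep xpredT) //=; apply: eq_bigr => i _.
  by apply: eq_big => j; rewrite eq_sym // => ij; rewrite updC // eq_sym.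
rewrite [X in _ - (_ - X)]addrC opprB addrA subrK.
rewrite opprD addrACA subrr addr0 opprD addrACA E /act; congr (_ + _).
rewrite -sumrB -sumrN; apply: eq_bigr => i _.
rewrite -E; have /= <- := additive_funN _ (MD b i (ltn_ord i)).
have /= <- := MD b i (ltn_ord i) _ _.
have /= <- := additive_funN _ (MD b i (ltn_ord i)).
by rewrite opprB.
Qed.

Lemma eq_act n phi psi M M' b :
  phi =1 psi -> M =1 M' -> act n phi M b = act n psi M' b.
Proof.
move=> E EM; rewrite /act E EM; congr (_ - _).
by apply: eq_bigr => i _; rewrite EM E.
Qed.

Lemma act_add n phi psi M b : multiadditive n M ->
  act n (fun x => phi x + psi x) M b = act n phi M b + act n psi M b.
Proof.
move=> MD; rewrite /act addrACA -opprD -big_split; congr (_ + _ - _).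
by apply: eq_bigr => i _ /=; rewrite -MD.
Qed.

(** Sequences are infinite, but a map in [n] variables reads its first [n]
    entries only. *)
Definition reads_first n M :=
  forall b b', (forall i, (i < n)%N -> b i = b' i) -> M b = M b'.

Lemma act_reads_first n phi M : reads_first n M -> reads_first n (act n phi M).
Proof.
move=> ML b b' E; rewrite /act (ML b b' E); congr (_ - _).
apply: eq_bigr => i _; apply: ML => j lt_jn.
by rewrite /upd !E.
Qed.

End MultiAdditive.

Section Braces.
Variables (V : zmodType) (st : V -> V -> V).
Implicit Types (a c x y : V) (b : nat -> V).

Fixpoint brace n a b : V :=
  if n is p.+1 then
    st (brace p a b) (b p)
    - \sum_(i < p) brace p a (upd b i (st (b i) (b p)))
  else a.

Lemma braceS n a b : brace n.+1 a b = act n (st^~ (b n)) (brace n a) b.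
Proof. by []. Qed.

Lemma brace_reads_first n a : reads_first n (brace n a).
Proof.
elim: n => // n IH b b' E; rewrite !braceS E //.
by apply: act_reads_first IH _ _ _ => i lt_in; apply: E; rewrite ltnS ltnW.
Qed.

Section Filtered.
Variable G : nat -> V -> Prop.
Hypothesis G0 : forall k, G k 0.
Hypothesis GB : forall k x y, G k x -> G k y -> G k (x - y).
Hypothesis stG : forall k l x y, G k x -> G l y -> G (k + l)%N (st x y).

Lemma brace_fil n k (f : nat -> nat) a b : G k a -> (forall i, G (f i) (b i)) ->
  G (k + \sum_(i < n) f i)%N (brace n a b).
Proof.
move=> Ga; elim: n f b => [|n IH] f b Gb; first by rewrite big_ord0 addn0.
have GD j x y : G j x -> G j y -> G j (x + y).
  by move=> Gx Gy; rewrite -[y]opprK; apply: (GB) => //; rewrite -sub0r; apply: GB.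
rewrite big_ord_recr /= addnA; apply: GB; first by apply: stG => //; apply: IH.
apply: (big_ind (G _)) => // [x y|i _]; [exact: GD | rewrite -addnA].
have -> : (\sum_(j < n) f j + f n = \sum_(j < n) (f j + (val j == i) * f n))%N.
  rewrite big_split /=; congr addn.
  rewrite (bigD1 i) //= eqxx mul1n big1 ?addn0 // => j.
  by rewrite -val_eqE => /negPf ->.
apply: (IH (fun j => f j + (j == i) * f n)%N) => j.
by rewrite /upd; case: eqP => [->|_]; rewrite ?mul1n ?addn0 //; apply: stG.
Qed.

End Filtered.

Hypothesis stDl : forall c, additive_fun (st^~ c).
Hypothesis stDr : forall c, additive_fun (st c).

Lemma braceS_upd n a b z :
  brace n.+1 a (upd b n z) = act n (st^~ z) (brace n a) b.
Proof.
have E : brace n a (upd b n z) = brace n a b.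
  by apply: brace_reads_first => j jn; rewrite upd_neq ?ltn_eqF.
rewrite braceS upd_eq /act E; congr (_ - _).
apply: eq_bigr => j _; apply: brace_reads_first => k kn.
by rewrite /upd !(ltn_eqF kn) (ltn_eqF (ltn_ord j)).
Qed.

Lemma brace_multiadditive n a : multiadditive n (brace n a).
Proof.
elim: n => // n IH b i; rewrite ltnS leq_eqVlt => /orP[/eqP ->|lt_in] x y.
  rewrite !braceS_upd -act_add //; apply: eq_act => // z; exact: stDr.
have E z : brace n.+1 a (upd b i z) = act n (st^~ (b n)) (brace n a) (upd b i z).
  by rewrite braceS upd_neq // gtn_eqF.
by rewrite !E; apply: act_multiadditive.
Qed.

Lemma act_braceS n phi a b :
  act n.+1 phi (brace n.+1 a) b =
  act n phi (act n (st^~ (b n)) (brace n a)) b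
  - act n (st^~ (phi (b n))) (brace n a) b.
Proof.
rewrite -braceS_upd {1}/act big_ord_recr opprD addrA; congr (_ - _).
rewrite [RHS]/act; congr (_ - _); apply: eq_bigr => i _.
by rewrite [LHS]braceS upd_neq /= ?gtn_eqF.
Qed.

(** An instance of [act_comm]: the commutator of a derivation D with the right
    multiplication by c is the right multiplication by D(c). *)
Lemma brace_deriv n a b (D : V -> V) : additive_fun D ->
  (forall x y, D (st x y) = st (D x) y + st x (D y)) ->
  D (brace n a b) = brace n (D a) b + \sum_(i < n) brace n a (upd b i (D (b i))).
Proof.
move=> DD Dst; apply/eqP; rewrite -subr_eq; apply/eqP.
rewrite -[LHS]/(act n D (brace n a) b); elim: n b => [|n IH] b.
  by rewrite /act big_ord0 subr0.
have MD := @brace_multiadditive n a.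
rewrite act_braceS -(@act_comm _ n D (st^~ (b n)) (st^~ (D (b n)))) // => [|x].
  by rewrite subKr braceS; apply: eq_act.
by rewrite Dst addrAC subrr add0r.
Qed.

Section Symmetry.
Hypothesis st_rsym : forall x y z,
  st (st x y) z - st x (st y z) = st (st x z) y - st x (st z y).

Definition swap_at i j := if j == i then i.+1 else if j == i.+1 then i else j.

Lemma swap_atK i : involutive (swap_at i).
Proof.
move=> j; rewrite /swap_at; case: (j =P i) => [->|/eqP ji].
  by rewrite eqxx gtn_eqF.
by case: (j =P i.+1) => [->|/eqP jS]; rewrite ?eqxx // (negPf ji) (negPf jS).
Qed.

Lemma swap_at_lt i n j : (i.+1 < n)%N -> (j < n)%N -> (swap_at i j < n)%N.
Proof.
by move=> lt_in lt_jn; rewrite /swap_at; do 2?case: ifP => // _; apply: ltnW.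
Qed.

Lemma upd_swap b i j x :
  upd (b \o swap_at i) j x = upd b (swap_at i j) x \o swap_at i.
Proof.
apply/funext => k; rewrite /upd /= (can2_eq (@swap_atK i) (@swap_atK i)).
by rewrite swap_atK.
Qed.

(** For the last two arguments x and y, the recursion gives the action of R_y R_x
    minus that of R_(x * y). Exchanging x and y changes the first term by a
    bracket of actions, which right symmetry identifies with the action of the
    right multiplication by x * y - y * x: this compensates the second term. *)
Lemma brace_swap n a b i : (i.+1 < n)%N ->
  brace n a (b \o swap_at i) = brace n a b.
Proof.
elim: n b => // n IH b; rewrite ltnS leq_eqVlt => /orP[/eqP <-|lt_in]; last first.
  have E : swap_at i n = n.
    by rewrite /swap_at !gtn_eqF // (ltn_trans _ lt_in).
  rewrite !braceS /act /= E IH //; congr (_ - _).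
  pose s (j : 'I_n) := Ordinal (swap_at_lt lt_in (ltn_ord j)).
  have sK : involutive s by move=> j; apply: val_inj; apply: swap_atK.
  rewrite [RHS](reindex_inj (inv_inj sK)); apply: eq_bigr => j _ /=.
  by rewrite upd_swap IH.
have MD := @brace_multiadditive i a.
have E (M : (nat -> V) -> V) : reads_first i M -> M (b \o swap_at i) = M b.
  by apply => j lt_ji; rewrite /= /swap_at !ltn_eqF // ltnW.
have EI : swap_at i i = i.+1 by rewrite /swap_at eqxx.
have ES : swap_at i i.+1 = i by rewrite -EI swap_atK.
set x := b i; set y := b i.+1; set M := brace i a.
have -> : brace i.+2 a b =
    act i (st^~ y) (act i (st^~ x) M) b - act i (st^~ (st x y)) M b.
  by rewrite braceS act_braceS.
have -> : brace i.+2 a (b \o swap_at i) =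
    act i (st^~ x) (act i (st^~ y) M) b - act i (st^~ (st y x)) M b.
  have ML := @brace_reads_first i a.
  rewrite braceS act_braceS /= EI ES !E //; apply: act_reads_first => //.
  exact: act_reads_first.
pose theta z := st z (st x y) - st z (st y x).
have -> : act i (st^~ (st x y)) M b =
    act i theta M b + act i (st^~ (st y x)) M b.
  by rewrite -act_add //; apply: eq_act => // z; rewrite subrK.
rewrite -(@act_comm _ i (st^~ y) (st^~ x) theta) // => [|z].
  by rewrite [in RHS]opprD [RHS]addrA subKr.
have /eqP := st_rsym z x y; rewrite subr_eq => /eqP ->.
by rewrite addrC 2!addrA addNr add0r addrC.
Qed.

(** Moves an exceptional argument to the last place, where the recursive
    definition of braces applies. *)
Lemma brace_const_upd n a c i x : (i <= n)%N ->
  brace n.+1 a (upd (fun=> c) i x) = brace n.+1 a (upd (fun=> c) n x).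
Proof.
move=> le_in; rewrite -{3}(subnKC le_in).
have: (i + (n - i) <= n)%N by rewrite subnKC.
elim: (n - i)%N => [|p IH lt_pn]; first by rewrite addn0.
rewrite IH; last by apply: leq_trans lt_pn; rewrite leq_add2l.
rewrite -[RHS](@brace_swap _ _ _ (i + p)); last by rewrite ltnS -addnS.
rewrite -[in RHS](swap_atK (i + p) (i + p.+1)%N) -upd_swap.
by rewrite [in RHS]addnS /swap_at gtn_eqF // eqxx.
Qed.

End Symmetry.

End Braces.

(** Parametricity; it compares the braces of formal series with the braces of
    the values of these series. *)
Lemma brace_rel (V V' : zmodType) (st : V -> V -> V) (st' : V' -> V' -> V')
    (R : V -> V' -> Prop) :
  R 0 0 ->
  (forall x x' y y', R x x' -> R y y' -> R (x - y) (x' - y')) ->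
  (forall x x' y y', R x x' -> R y y' -> R (st x y) (st' x' y')) ->
  forall n a a' b b', R a a' -> (forall i, R (b i) (b' i)) ->
  R (brace st n a b) (brace st' n a' b').
Proof.
move=> R0 RB Rst n a a' b b' Ra; elim: n b b' => // n IH b b' Rb /=.
apply: (RB); first by apply: Rst => //; apply: IH.
have RD x x' y y' : R x x' -> R y y' -> R (x + y) (x' + y').
  by move=> Rx Ry; rewrite -[y]opprK -[y']opprK -(sub0r y) -(sub0r y'); auto.
apply: (big_ind2 R) => // i _; apply: IH => j.
by rewrite /upd; case: eqP => // _; apply: Rst.
Qed.

(** * Formal power series with coefficients in a pre-Lie ring *)

Section Series.
Variables (V : zmodType) (st : V -> V -> V).
Implicit Types (s t u : nat -> V).
Hypothesis stDl : forall c, additive_fun (st^~ c).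
Hypothesis stDr : forall c, additive_fun (st c).

Let st0l c : st 0 c = 0. Proof. exact: additive_fun0 (stDl c). Qed.
Let st0r c : st c 0 = 0. Proof. exact: additive_fun0 (stDr c). Qed.

Definition conv s t : nat -> V :=
  fun m => \sum_(i < m.+1) st (s i) (t (m - i)%N).

Definition sderiv s : nat -> V := fun m => s m.+1 *+ m.+1.

Definition sconst x : nat -> V := fun m => if m is 0 then x else 0.

(** The t-adic filtration. *)
Definition sfil k s : Prop := forall m, (m < k)%N -> s m = 0.

Lemma convDl t : additive_fun (conv^~ t).
Proof.
move=> s u; apply/funext => m; rewrite -[RHS]/(conv s t m + conv u t m) -big_split.
by apply: eq_bigr => i _; apply: stDl.
Qed.

Lemma convDr s : additive_fun (conv s).
Proof.
move=> t u; apply/funext => m; rewrite -[RHS]/(conv s t m + conv s u m) -big_split.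
by apply: eq_bigr => i _; apply: stDr.
Qed.

Lemma conv_const s x m : conv s (sconst x) m = st (s m) x.
Proof.
rewrite /conv big_ord_recr /= subnn big1 ?add0r // => i _.
by rewrite /sconst -(@prednK (m - i)) ?subn_gt0.
Qed.

(** Both ways of multiplying three series are sums over the same index set, so
    that the associator of series is the sum of the associators of their
    coefficients. *)
Lemma convAl s t u m : conv (conv s t) u m =
  \sum_(i < m.+1) \sum_(j < (m - i).+1) st (st (s i) (t j)) (u (m - i - j)%N).
Proof.
elim: m s t => [|m IH] s t.
  by rewrite /conv !big_ord1 /= !subn0.
rewrite [LHS]big_ord_recl [RHS]big_ord_recl [X in _ = X + _]big_ord_recl.
rewrite /= !subn0 [X in st X _]/conv big_ord1 /= subn0 -addrA; congr (_ + _).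
rewrite -[X in _ = _ + X](IH (fun i => s i.+1)) -big_split; apply: eq_bigr => i _.
rewrite /bump /= !add1n !subSS -stDl; congr (st _ _).
by rewrite /conv big_ord_recl subn0.
Qed.

Lemma convAr s t u m : conv s (conv t u) m =
  \sum_(i < m.+1) \sum_(j < (m - i).+1) st (s i) (st (t j) (u (m - i - j)%N)).
Proof.
by apply: eq_bigr => i _; rewrite (additive_fun_sum _ _ _ (stDr _)).
Qed.

Lemma conv_rsym :
  (forall x y z,
    st (st x y) z - st x (st y z) = st (st x z) y - st x (st z y)) ->
  forall s t u,
  conv (conv s t) u - conv s (conv t u) = conv (conv s u) t - conv s (conv u t).
Proof.
move=> rsym s t u; apply/funext => m.
rewrite !fctE !convAl !convAr -!sumrB; apply: eq_bigr => i _.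
rewrite -!sumrB (reindex_inj rev_ord_inj); apply: eq_bigr => j _ /=.
have lt_j : (j <= m - i)%N by rewrite -ltnS.
by rewrite subSS subKn // rsym.
Qed.

Lemma sderivD : additive_fun sderiv.
Proof. by move=> s t; apply/funext => m; rewrite /sderiv !fctE mulrnDl. Qed.

Lemma sderiv_conv s t :
  sderiv (conv s t) = conv (sderiv s) t + conv s (sderiv t).
Proof.
have stMl x c n : st (x *+ n) c = st x c *+ n.
  by elim: n => // n IH; rewrite !mulrS stDl IH.
have stMr x c n : st c (x *+ n) = st c x *+ n.
  by elim: n => // n IH; rewrite !mulrS stDr IH.
apply/funext => m; rewrite fctE /sderiv /conv -sumrMnl.
transitivity (\sum_(i < m.+2) st (s i) (t (m.+1 - i)%N) *+ i
            + \sum_(i < m.+2) st (s i) (t (m.+1 - i)%N) *+ (m.+1 - i)).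
  by rewrite -big_split; apply: eq_bigr => i _ /=; rewrite -mulrnDr subnKC // (leq_ord i).
congr (_ + _).
  by rewrite big_ord_recl mulr0n add0r; apply: eq_bigr => i _; rewrite stMl.
rewrite big_ord_recr /= subnn addr0; apply: eq_bigr => i _.
by rewrite stMr subSn // (leq_ord i).
Qed.

Lemma sderiv_const x : sderiv (sconst x) = 0.
Proof. by apply/funext => m; rewrite /sderiv mul0rn. Qed.

Lemma sfilB k s t : sfil k s -> sfil k t -> sfil k (s - t).
Proof. by move=> Gs Gt m lt_mk; rewrite -[LHS]/(s m - t m) Gs ?Gt ?subr0. Qed.

Lemma sfil_conv k l s t : sfil k s -> sfil l t -> sfil (k + l) (conv s t).
Proof.
move=> Gs Gt m lt_m; apply: big1 => i _.
have [/Gs ->|le_ki] := ltnP i k; first exact: st0l.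
rewrite (Gt (m - i)%N) ?st0r // ltn_subLR; last exact: leq_ord.
by apply: leq_trans lt_m _; rewrite leq_add2r.
Qed.

End Series.

(** * Filtered left-unital pre-Lie algebras *)

(** The structure of the degree 0 part, where all signs are 1. Noncommutative
    power series, filtered by their order, are a second instance. *)
Record filtered_prelie (K : fieldType) (V : lmodType K) (F : nat -> set V)
    (st : V -> V -> V) (e : V) : Prop := FilteredPrelie {
  fp_fil : filtration F;
  fp_linl : forall c, linear (st^~ c);
  fp_linr : forall c, linear (st c);
  fp_st : forall k l x y, F k x -> F l y -> F (k + l)%N (st x y);
  fp_rsym : forall x y z,
    st (st x y) z - st x (st y z) = st (st x z) y - st x (st z y);
  fp_unit : forall x, st e x = x }.

Definition congF (K : fieldType) (V : lmodType K) (F : nat -> set V) k x y :=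
  F k (x - y).

Section Congruence.
Variables (K : fieldType) (V : lmodType K) (F : nat -> set V).
Hypothesis fF : filtration F.
Local Notation "x =[ k ] y" := (congF F k x y) (at level 70, k at level 0).

Lemma fil0 k : F k 0. Proof. exact: fil_zero. Qed.

Lemma filT x : F 0 x. Proof. by rewrite (fil_full fF). Qed.

Lemma filN k x : F k x -> F k (- x).
Proof. by move=> Fx; rewrite -sub0r; apply: filB => //; apply: fil0. Qed.

Lemma cong_refl k x : x =[k] x.
Proof. by rewrite /congF subrr; apply: fil0. Qed.

Lemma cong_sym k x y : x =[k] y -> y =[k] x.
Proof. by move=> /filN; rewrite opprB. Qed.

Lemma cong_trans k y x z : x =[k] y -> y =[k] z -> x =[k] z.
Proof. by move=> xy yz; rewrite /congF -(subrKA y); apply: filD. Qed.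

Lemma congD k x y x' y' : x =[k] x' -> y =[k] y' -> x + y =[k] x' + y'.
Proof. by move=> xx' yy'; rewrite /congF opprD addrACA; apply: filD. Qed.

Lemma congN k x y : x =[k] y -> - x =[k] - y.
Proof. by move=> xy; rewrite /congF -opprD; apply: filN. Qed.

Lemma congZ k (c : K) x y : x =[k] y -> c *: x =[k] c *: y.
Proof. by move=> xy; rewrite /congF -scalerBr; apply: filZ. Qed.

Lemma cong_sum k (I : Type) (r : seq I) (P : pred I) (u v : I -> V) :
  (forall i, P i -> u i =[k] v i) ->
  \sum_(i <- r | P i) u i =[k] \sum_(i <- r | P i) v i.
Proof. by move=> uv; rewrite /congF -sumrB; apply: fil_sum. Qed.

Lemma cong_le k l x y : (k <= l)%N -> x =[l] y -> x =[k] y.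
Proof. by move=> /fil_le; apply. Qed.

Lemma cong_fil k x y : x =[k] y -> F k y -> F k x.
Proof. by move=> xy Fy; rewrite -[x](subrK y); apply: filD. Qed.

Lemma cong0 k x : F k x -> x =[k] 0.
Proof. by rewrite /congF subr0. Qed.

Hypothesis cF : fcomplete F.

Lemma cong_eq x y : (forall k, x =[k] y) -> x = y.
Proof.
move=> xy; have [|z [_ zP]] := cF (c := fun k => fcoset F k x).
  split=> [k|k z]; first by exists x.
  exact: (fil_decr fF).
rewrite -(zP x) // -(zP y) //; apply/funext => k; apply/seteqP.
split=> w wP; first exact: (cong_trans wP (cong_sym (xy k))).
exact: (cong_trans wP (xy k)).
Qed.

Lemma fsum_cong N u : (forall n, F n (u n)) -> fsum F u =[N] \sum_(i < N) u i.
Proof.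
move=> Fu; apply: fil_fsum => //; exists N => // n /= /subnKC <-.
elim: (n - N)%N => [|p IH]; first by rewrite addn0 subrr; apply: fil0.
rewrite addnS big_ord_recr /= addrAC; apply: filD => //.
exact: (fil_le fF (leq_addr p N)) (Fu _).
Qed.

End Congruence.

Section Exponential.
Variables (K : fieldType) (V : lmodType K) (F : nat -> set V).
Variables (st : V -> V -> V) (e : V).
Hypothesis charK0 : [pchar K] =i pred0.
Hypothesis fp : filtered_prelie F st e.
Local Notation "x =[ k ] y" := (congF F k x y) (at level 70, k at level 0).

Let fF : filtration F := fp_fil fp.

Lemma st_addl c : additive_fun (st^~ c).
Proof. by move=> x y; have := fp_linl fp c 1 x y; rewrite !scale1r. Qed.

Lemma st_addr c : additive_fun (st c).
Proof. by move=> x y; have := fp_linr fp c 1 x y; rewrite !scale1r. Qed.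

Lemma st_scalel a x c : st (a *: x) c = a *: st x c.
Proof.
have := fp_linl fp c a x 0; rewrite !addr0 => ->.
by rewrite (additive_fun0 (st_addl c)) addr0.
Qed.

Lemma st_scaler a x c : st c (a *: x) = a *: st c x.
Proof.
have := fp_linr fp c a x 0; rewrite !addr0 => ->.
by rewrite (additive_fun0 (st_addr c)) addr0.
Qed.

Lemma cong_st k x x' y y' : x =[k] x' -> y =[k] y' -> st x y =[k] st x' y'.
Proof.
move=> xx' yy'; apply: (cong_trans fF (y := st x' y)); rewrite /congF.
  rewrite -(additive_funB _ _ (st_addl y)) -[k]addn0.
  by apply: (fp_st fp) => //; apply: filT.
rewrite -(additive_funB _ _ (st_addr x')) -[k]add0n.
by apply: (fp_st fp) => //; apply: filT.
Qed.

Lemma natK_neq0 n : n.+1%:R != 0 :> K.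
Proof. by rewrite ((pcharf0P K).1 charK0). Qed.

Lemma factK_neq0 n : n`!%:R != 0 :> K.
Proof. by rewrite ((pcharf0P K).1 charK0) -lt0n fact_gt0. Qed.

(** The truncation of exp(R_l)(a), where R_l is the right multiplication by l. *)
Definition rexp N l a := \sum_(n < N) (n`!%:R : K)^-1 *: iter n (st^~ l) a.

(** Evaluation at t = 1, modulo F_N. *)
Definition eval_series N (s : nat -> V) := \sum_(m < N) s m.

Lemma fil_conv (s t : nat -> V) : (forall m, F m (s m)) ->
  (forall m, F m (t m)) -> forall m, F m (conv st s t m).
Proof.
move=> Fs Ft m; apply: fil_sum => // i _.
by rewrite -{1}(subnKC (leq_ord i)); apply: (fp_st fp).
Qed.

Lemma eval_conv N s t : (forall m, F m (s m)) -> (forall m, F m (t m)) ->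
  st (eval_series N s) (eval_series N t) =[N] eval_series N (conv st s t).
Proof.
move=> Fs Ft.
have -> : eval_series N (conv st s t) =
    \sum_(i < N) \sum_(j < N - i) st (s i) (t j).
  elim: N => [|N IH]; first by rewrite /eval_series !big_ord0.
  rewrite /eval_series big_ord_recr /= -/(eval_series N _) IH /conv.
  rewrite !big_ord_recr /= subSn // subnn big_ord1 addrA -big_split.
  congr (_ + _); apply: eq_bigr => i _ /=.
  by rewrite subSn ?big_ord_recr // ltnW.
rewrite (additive_fun_sum _ _ _ (st_addl _)); apply: cong_sum => // i _.
rewrite (additive_fun_sum _ _ _ (st_addr _)).
rewrite -!(big_mkord xpredT (fun j => st (s i) (t j))).
rewrite [X in X =[_] _](@big_cat_nat _ _ _ (N - i)) ?leq_subr //=.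
rewrite /congF addrAC subrr add0r big_nat; apply: fil_sum => // j /andP[le_j _].
apply: (fil_le fF _ (fp_st fp (Fs i) (Ft _))).
by rewrite -leq_subLR.
Qed.

Section Circle.
Variables (l a : V).

Let sa := sconst a.
Let sl := sconst l.
(* The series e^(tl) - 1. *)
Let sb (m : nat) : V := if m is 0 then 0 else (m`!%:R : K)^-1 *: iter m (st^~ l) e.

Let mul := conv st.
Let B n := brace mul n sa (fun=> sb).
Let B1 n x := brace mul n.+1 sa (upd (fun=> sb) n x).

Let mulDl c : additive_fun (mul^~ c). Proof. exact: convDl st_addl c. Qed.
Let mulDr c : additive_fun (mul c). Proof. exact: convDr st_addr c. Qed.

Lemma scale_factS m : (m.+1`!%:R : K)^-1 *+ m.+1 = (m`!%:R)^-1.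
Proof.
by rewrite factS natrM invfM -mulrnAl -[_ *+ m.+1]mulr_natr mulVf ?mul1r // natK_neq0.
Qed.

Let sderiv_exp : sderiv sb = sl + mul sb sl.
Proof.
apply/funext => m; rewrite -[RHS]/(sconst l m + conv st sb (sconst l) m) conv_const //; last first.
  exact: st_addr.
rewrite /sderiv {1}/sb scalerMnl scale_factS.
case: m => [|m]; last by rewrite /= add0r -st_scalel.
by rewrite /= fact0 invr1 scale1r (fp_unit fp) (additive_fun0 (st_addl _)) addr0.
Qed.

Let B1D n : additive_fun (B1 n).
Proof. exact: brace_multiadditive. Qed.

Let brace_series_deriv n : sderiv (B n.+1) = (B1 n sl + B1 n (mul sb sl)) *+ n.+1.
Proof.
have brace0l k b : brace mul k 0 b = 0.
  elim: k b => // k IH b; rewrite braceS /act IH (additive_fun0 (mulDl _)) sub0r.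
  by rewrite big1 ?oppr0.
rewrite (brace_deriv mulDl mulDr) //; first last.
- by move=> x y; apply: sderiv_conv; [exact: st_addl | exact: st_addr].
- exact: sderivD.
rewrite sderiv_const brace0l add0r sderiv_exp -B1D.
rewrite (eq_bigr (fun=> B1 n (sl + mul sb sl))) => [|i _].
  by rewrite sumr_const card_ord.
apply: brace_const_upd => //; last by rewrite -ltnS.
by apply: conv_rsym; [exact: st_addl | exact: st_addr | exact: fp_rsym fp].
Qed.

Let brace_series_mul n : mul (B n) sl = B1 n sl +
  (if n is p.+1 then B1 p (mul sb sl) *+ p.+1 else 0).
Proof.
rewrite /B1 braceS_upd /act -addrA; apply/eqP; rewrite addrC -subr_eq subrr eq_sym.
rewrite addrC subr_eq0; apply/eqP; case: n => [|n]; first by rewrite big_ord0.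
rewrite (eq_bigr (fun=> B1 n (mul sb sl))) => [|i _].
  by rewrite sumr_const card_ord.
apply: brace_const_upd => //; last by rewrite -ltnS.
by apply: conv_rsym; [exact: st_addl | exact: st_addr | exact: fp_rsym fp].
Qed.

Let brace_sfil n b : (forall i, sfil 1 (b i)) -> sfil n (brace mul n sa b).
Proof.
move=> Gb; rewrite -[X in sfil X]addn0 addnC.
have {1}-> : n = (\sum_(i < n) 1)%N by rewrite sum1_card card_ord.
apply: (@brace_fil _ mul (@sfil V) _ _ _ n 0 (fun=> 1%N)) => // [k|].
  exact: sfilB.
by move=> *; apply: sfil_conv => //; [exact: st_addl | exact: st_addr].
Qed.

Let sfil_sb : sfil 1 sb. Proof. by case. Qed.

(** The series f(t) = a o e^(tl) satisfies f' = f * l and f(0) = a. *)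
Let circ_coef m : \sum_(n < m.+1) (n`!%:R : K)^-1 *: B n m =
  (m`!%:R : K)^-1 *: iter m (st^~ l) a.
Proof.
elim: m => [|m IH]; first by rewrite big_ord1.
suff E : (\sum_(n < m.+2) (n`!%:R : K)^-1 *: B n m.+1) *+ m.+1
    = (m`!%:R : K)^-1 *: iter m.+1 (st^~ l) a.
  apply: (scalerI (natK_neq0 m)); rewrite !scaler_nat E scalerMnl.
  by rewrite scale_factS.
rewrite iterS -st_scalel -IH big_ord_recl mulrnDl.
have -> : B 0 m.+1 = 0 by [].
rewrite scaler0 mul0rn add0r -sumrMnl (additive_fun_sum _ _ _ (st_addl l)).
pose D n x := (n`!%:R : K)^-1 *: B1 n x m.
have natmulE (s : nat -> V) n : (s *+ n) m = s m *+ n.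
  by elim: n => // n IHn; rewrite !mulrS -IHn.
have DE n x : (n.+1`!%:R : K)^-1 *: (B1 n x *+ n.+1) m = D n x.
  by rewrite natmulE -scalerMnr scalerMnl scale_factS.
transitivity (\sum_(n < m.+1) (D n sl + D n (mul sb sl))).
  apply: eq_bigr => n _; rewrite lift0 scalerMnr.
  rewrite -[_ *+ m.+1]/(sderiv (B n.+1) m) brace_series_deriv.
  by rewrite -B1D DE /D B1D -scalerDr.
transitivity (\sum_(n < m.+1) (D n sl +
    if nat_of_ord n is p.+1 then D p (mul sb sl) else 0)).
  rewrite !big_split; congr (_ + _).
  rewrite [LHS]big_ord_recr [RHS]big_ord_recl /= add0r.
  have -> : D m (mul sb sl) = 0.
    rewrite /D /B1 brace_sfil ?scaler0 // => i.
    rewrite /upd; case: eqP => // _.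
    exact: (sfil_conv st_addl st_addr sfil_sb (k := 1) (l := 0)).
  by rewrite addr0; apply: eq_bigr.
apply: eq_bigr => n _; rewrite st_scalel -(conv_const st_addr) -/sl -/mul.
rewrite brace_series_mul -[X in _ = _ *: X]/(B1 n sl m + _ m) scalerDr; congr (_ + _).
case: (nat_of_ord n) => [|p]; last by rewrite DE.
by rewrite -[RHS]/(_ *: 0) scaler0.
Qed.

(** The identity of series [circ_coef] is evaluated at t = 1: the relation R
    between a filtered series and its value is compatible with the product,
    hence with braces. *)
Lemma circ_rexp N b : F 1 l -> b =[N] rexp N l e - e ->
  \sum_(n < N) (n`!%:R : K)^-1 *: brace st n a (fun=> b) =[N] rexp N l a.
Proof.
move=> Fl bE; have F0l := filT fF.
pose R (s : nat -> V) x := (forall m, F m (s m)) /\ x =[N] eval_series N s.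
have RB n : R (B n) (brace st n a (fun=> b)).
  apply: (@brace_rel _ _ mul st R).
  - split=> [m|]; first exact: fil0.
    by rewrite /eval_series big1 //; apply: (cong_refl fF).
  - move=> s x t y [Fs xs] [Ft yt]; split=> [m|]; first exact: (filB fF (Fs m) (Ft m)).
    rewrite (_ : eval_series N (s - t) = eval_series N s - eval_series N t).
      by apply: (congD fF) => //; apply: (congN fF).
    exact: sumrB.
  - move=> s x t y [Fs xs] [Ft yt]; split; first exact: fil_conv.
    by apply: (cong_trans fF) (eval_conv _ Fs Ft); apply: cong_st.
  - split=> [[|m]|] //; first exact: fil0.
    rewrite /eval_series; case: N {bE R} => [|N]; first exact: F0l.
    by rewrite big_ord_recl /= big1 // addr0; apply: (cong_refl fF).
  move=> _; split=> [[|m]|]; first exact: fil0.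
    apply: (filZ _ fF); elim: m.+1 => [|k Fk]; first exact: F0l.
    by rewrite iterS -addn1; apply: (fp_st fp).
  apply: (cong_trans fF bE); rewrite /rexp /eval_series.
  case: N {bE R} => [|N]; first exact: F0l.
  rewrite !big_ord_recl /= fact0 invr1 scale1r addrAC subrr.
  exact: (cong_refl fF).
have -> : rexp N l a = \sum_(n < N) (n`!%:R : K)^-1 *: eval_series N (B n).
  rewrite /eval_series; under [RHS]eq_bigr do rewrite scaler_sumr.
  rewrite exchange_big; apply: eq_bigr => m _; rewrite -circ_coef.
  rewrite -!(big_mkord xpredT (fun n => (n`!%:R : K)^-1 *: B n m)).
  rewrite [RHS](@big_cat_nat _ _ _ m.+1) //= [X in _ = _ + X]big_nat_cond.
  rewrite [X in _ = _ + X]big1 ?addr0 // => n /andP[/andP[lt_mn _] _].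
  by rewrite /B brace_sfil ?scaler0.
by apply: (cong_sum fF) => n _; apply: congZ => //; apply: (RB n).2.
Qed.

End Circle.
End Exponential.

(** * The algebra of noncommutative power series *)

(** A copy of [ncseries] that carries the convolution product, and not the
    pointwise product of functions. *)
Definition ncs (K : fieldType) : Type := ncseries K.

Section NCSeries.
Variable K : fieldType.
Local Notation R := (ncs K).
Implicit Types (f g h : R) (w : seq bool).

HB.instance Definition _ := GRing.Lmodule.copy R (seq bool -> K^o).

(** Left quotients by letters reduce the product to a recursion on words, see
    [nc_mul_cons]. *)
Definition lquo (a : bool) f : R := fun w => f (a :: w).

Lemma nc_mul_nil f g : nc_mul f g [::] = f [::] * g [::].
Proof. by rewrite /nc_mul big_ord1. Qed.

Lemma nc_mul_cons f g a w :
  nc_mul f g (a :: w) = f [::] * g (a :: w) + nc_mul (lquo a f) g w.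
Proof. by rewrite /nc_mul big_ord_recl. Qed.

Lemma nc_mulDl : left_distributive (@nc_mul K : R -> R -> R) +%R.
Proof.
move=> f g h; apply/funext => w.
rewrite -[RHS]/(nc_mul f h w + nc_mul g h w) -big_split.
by apply: eq_bigr => i _; rewrite /= mulrDl.
Qed.

Lemma nc_mulDr : right_distributive (@nc_mul K : R -> R -> R) +%R.
Proof.
move=> f g h; apply/funext => w.
rewrite -[RHS]/(nc_mul f g w + nc_mul f h w) -big_split.
by apply: eq_bigr => i _; rewrite /= mulrDr.
Qed.

Lemma nc_scalerAl c f g : c *: (nc_mul f g : R) = nc_mul (c *: f) g.
Proof.
apply/funext => w; rewrite -[LHS]/(c * nc_mul f g w) mulr_sumr.
by apply: eq_bigr => i _; rewrite mulrA.
Qed.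

Lemma nc_scalerAr c f g : c *: (nc_mul f g : R) = nc_mul f (c *: g).
Proof.
apply/funext => w; rewrite -[LHS]/(c * nc_mul f g w) mulr_sumr.
by apply: eq_bigr => i _; rewrite mulrCA.
Qed.

Lemma lquo_mul a f g :
  lquo a (nc_mul f g) = f [::] *: lquo a g + nc_mul (lquo a f) g :> R.
Proof. by apply/funext => w; rewrite /lquo nc_mul_cons. Qed.

Lemma nc_mulA : associative (@nc_mul K : R -> R -> R).
Proof.
move=> f g h; apply/funext => w; elim: w f => [|a w IH] f.
  by rewrite !nc_mul_nil mulrA.
rewrite !nc_mul_cons lquo_mul nc_mulDl -nc_scalerAl nc_mul_nil IH mulrDr -!addrA.
by rewrite mulrA.
Qed.

Lemma nc_mul1r : left_id (@nc_one K : R) (@nc_mul K).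
Proof.
move=> f; apply/funext => -[|a w]; first by rewrite nc_mul_nil mul1r.
rewrite nc_mul_cons mul1r -[RHS]addr0; congr (_ + _).
by apply: big1 => i _; rewrite /lquo /nc_one mul0r.
Qed.

Lemma nc_mulr1 : right_id (@nc_one K : R) (@nc_mul K).
Proof.
move=> f; apply/funext => w; elim: w f => [|a w IH] f.
  by rewrite nc_mul_nil mulr1.
by rewrite nc_mul_cons mulr0 add0r IH.
Qed.

Lemma nc_one_neq0 : (@nc_one K : R) != 0.
Proof.
apply/negP => /eqP/(congr1 (fun f : R => f [::]))/eqP; apply/negP.
exact: oner_neq0.
Qed.

HB.instance Definition _ := GRing.Zmodule_isNzRing.Build R
  nc_mulA nc_mul1r nc_mulr1 nc_mulDl nc_mulDr nc_one_neq0.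
HB.instance Definition _ := GRing.Lmodule_isLalgebra.Build K R nc_scalerAl.
HB.instance Definition _ := GRing.Lalgebra_isAlgebra.Build K R nc_scalerAr.

Definition ncF N : set R := [set f | forall w, (size w < N)%N -> f w = 0].

Lemma ncF_prelie : filtered_prelie ncF (@GRing.mul R) 1.
Proof.
split; first split.
- by apply/seteqP; split.
- by move=> k f Ff w /ltnW; apply: Ff.
- by [].
- move=> k c f g Ff Fg w lt_w.
  by rewrite -[LHS]/(c * f w + g w) Ff // Fg // mulr0 addr0.
- by move=> h c f g; rewrite mulrDl scalerAl.
- by move=> h c f g; rewrite mulrDr scalerAr.
- move=> k l f g Ff Fg w lt_w; apply: big1 => i _.
  have [lt_ik|le_ki] := ltnP i k.
    by rewrite Ff ?mul0r // size_takel // leq_ord.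
  rewrite Fg ?mulr0 // size_drop ltn_subLR; last exact: leq_ord.
  by apply: leq_trans lt_w _; rewrite leq_add2r.
- by move=> f g h; rewrite !mulrA !subrr.
- exact: mul1r.
Qed.

(** The Euler derivation, whose eigenvectors are the homogeneous series. *)
Definition euler f : R := fun w => (size w)%:R * f w.

Lemma eulerD : additive_fun euler.
Proof. by move=> f g; apply/funext => w; apply: mulrDr. Qed.

Lemma eulerZ c f : euler (c *: f) = c *: euler f.
Proof. by apply/funext => w; apply: mulrCA. Qed.

Lemma eulerM f g : euler (f * g) = euler f * g + f * euler g.
Proof.
apply/funext => w; rewrite -[RHS]/((euler f * g) w + (f * euler g) w).
rewrite -[LHS]/(_ * nc_mul f g w) mulr_sumr -big_split; apply: eq_bigr => i _ /=.
rewrite /euler -[in RHS]mulrA [f _ * (_ * _)]mulrCA -mulrDl -natrD.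
by rewrite -size_cat cat_take_drop.
Qed.

Lemma euler1 : euler 1 = 0.
Proof. by apply/funext => -[|a w]; rewrite /euler ?mul0r ?mulr0. Qed.

Lemma euler_fil N f : ncF N f -> ncF N (euler f).
Proof. by move=> Ff w /Ff; rewrite /euler => ->; rewrite mulr0. Qed.

Lemma euler_var b : euler (nc_var K b) = nc_var K b.
Proof.
apply/funext => w; rewrite /euler /nc_var; case: eqP => [->|_].
  by rewrite mul1r.
by rewrite mulr0.
Qed.

End NCSeries.

(** * Exponentials and commutators *)

Section Commutators.
Variable R : pzRingType.
Implicit Types (w y : R).

Definition commr y w : R := w * y - y * w.

Lemma commr_step y w : w * y = y * w + commr y w.
Proof. by rewrite addrC subrK. Qed.

(** The right multiplication by y is the sum of the left multiplication by y
    and of the bracket with y, which commute: this is the binomial formula. *)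
Lemma mul_pow_commr n y w :
  w * y ^+ n = \sum_(i < n.+1) (y ^+ i * iter (n - i) (commr y) w) *+ 'C(n, i).
Proof.
elim: n w => [|n IH] w; first by rewrite big_ord1 mulr1 mul1r.
rewrite exprS mulrA (commr_step y w) mulrDl -mulrA !IH mulr_sumr.
have -> : \sum_(i < n.+1) (y ^+ i * iter (n - i) (commr y) (commr y w)) *+ 'C(n, i)
    = \sum_(i < n.+2) (y ^+ i * iter (n.+1 - i) (commr y) w) *+ 'C(n, i).
  rewrite [RHS]big_ord_recr /= bin_small // mulr0n addr0.
  by apply: eq_bigr => i _; rewrite -iterSr subSn // leq_ord.
rewrite [X in _ + X = _]big_ord_recl [RHS]big_ord_recl !bin0 addrCA -big_split.
congr (_ + _); apply: eq_bigr => i _.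
by rewrite !lift0 binS mulrnDr addrC subSS mulrnAr mulrA -exprS.
Qed.

Lemma deriv_pow_commr (D : R -> R) n y : additive_fun D ->
  (forall u v, D (u * v) = D u * v + u * D v) ->
  D (y ^+ n.+1) =
  \sum_(i < n.+1) (y ^+ i * iter (n - i) (commr y) (D y)) *+ 'C(n.+1, i).
Proof.
move=> DD DM; elim: n => [|n IH]; first by rewrite big_ord1 mul1r expr1.
rewrite exprS DM IH mul_pow_commr mulr_sumr.
rewrite [X in X + _ = _]big_ord_recl -addrA [in RHS]big_ord_recl !bin0.
congr (_ + _); rewrite -big_split; apply: eq_bigr => i _.
by rewrite !lift0 [in RHS]binS [in RHS]mulrnDr subSS mulrnAr mulrA -exprS.
Qed.

End Commutators.

Section NCExp.
Variable K : fieldType.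
Hypothesis charK0 : [pchar K] =i pred0.
Local Notation R := (ncs K).
Local Notation F := (@ncF K).
Implicit Types (f g h y z : R) (w : seq bool).
Local Notation "x =[ k ] y" := (congF F k x y) (at level 70, k at level 0).

Let fp := ncF_prelie K.
Let fF : filtration F := fp_fil fp.

Let nrefl N f : f =[N] f. Proof. exact: (cong_refl fF N f). Qed.
Let nsym N f g : f =[N] g -> g =[N] f. Proof. exact: (@cong_sym _ _ _ fF). Qed.
Let ntrans N f g h : f =[N] g -> g =[N] h -> f =[N] h.
Proof. exact: (@cong_trans _ _ _ fF). Qed.
Let nZ N (c : K) f g : f =[N] g -> c *: f =[N] c *: g.
Proof. exact: (@congZ _ _ _ fF). Qed.
Let nfilZ N (c : K) f : F N f -> F N (c *: f).
Proof. exact: (@filZ _ _ _ N c f fF). Qed.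
Let nM k l f g : F k f -> F l g -> F (k + l)%N (f * g).
Proof. exact: (fp_st fp). Qed.

Lemma congM N f f' g g' : f =[N] f' -> g =[N] g' -> f * g =[N] f' * g'.
Proof. by move=> ff gg; apply: (cong_st fp ff gg). Qed.

Lemma cong_word N f g w : f =[N] g -> (size w < N)%N -> f w = g w.
Proof. by move=> fg lt_w; apply/eqP; rewrite -subr_eq0; apply/eqP/fg. Qed.

Lemma word_cong N f g : (forall w, (size w < N)%N -> f w = g w) -> f =[N] g.
Proof. by move=> fg w /fg E; apply/eqP; rewrite subr_eq0; apply/eqP. Qed.

Lemma ncF1 f : F 1 f <-> f [::] = 0.
Proof. by split=> [|f0 [|//]]; [apply | rewrite f0]. Qed.

Lemma ncF_pow n f : F 1 f -> F n (f ^+ n).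
Proof.
move=> Ff; elim: n => [|n IH]; first exact: filT.
by rewrite exprS -add1n; apply: nM.
Qed.

Lemma ncF_commr n y (w : R) : F 1 y -> F 1 w -> F n.+1 (iter n (commr y) w).
Proof.
move=> Fy Fw; elim: n => // n IH; apply: (filB fF).
  by rewrite -addn1; apply: nM.
by rewrite -add1n; apply: nM.
Qed.

(** Up to order N this is the exponential ([nc_exp_cong]), and it makes sense in
    terms of the ring operations. *)
Definition texp N f : R := \sum_(n < N) (n`!%:R : K)^-1 *: f ^+ n.

Lemma texp_cong N f g : f =[N] g -> texp N f =[N] texp N g.
Proof.
move=> fg; apply: (cong_sum fF) => n _; apply: nZ.
elim: (nat_of_ord n) => [|k IH]; first exact: nrefl.
by rewrite !exprS; apply: congM.
Qed.

Lemma nc_powE f n : nc_pow f n = f ^+ n.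
Proof. by elim: n => // n IH; rewrite exprS -IH. Qed.

Lemma nc_sumE (I : Type) (r : seq I) (P : pred I) (u : I -> R) w :
  (\sum_(i <- r | P i) u i) w = \sum_(i <- r | P i) u i w.
Proof. by elim/big_rec2: _ => // i y1 y2 _ <-. Qed.

Lemma nc_exp_cong N f : F 1 f -> (nc_exp f : R) =[N] texp N f.
Proof.
move=> Ff; apply: word_cong => w lt_w; rewrite /nc_exp /texp nc_sumE.
rewrite -[RHS](big_mkord xpredT (fun n => (n`!%:R)^-1 * (f ^+ n) w)).
rewrite [RHS](@big_cat_nat _ _ _ (size w).+1) //=.
rewrite [X in _ + X]big_nat_cond [X in _ + X]big1 ?addr0 => [|n].
  by apply: eq_bigr => n _; rewrite nc_powE.
by case/andP=> /andP[lt_wn _] _; rewrite ncF_pow ?mulr0.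
Qed.

Lemma bin_fact_inv n i : (i <= n)%N ->
  (n`!%:R : K)^-1 *+ 'C(n, i) = (i`!%:R)^-1 * ((n - i)`!%:R)^-1.
Proof.
move=> le_in; rewrite -(bin_fact le_in) !natrM !invfM -[LHS]mulr_natl mulrA mulfV ?mul1r //.
have := factK_neq0 charK0 n; rewrite -(bin_fact le_in) natrM mulf_eq0.
by case/norP.
Qed.

Let seq_exp y : nat -> R := fun i => (i`!%:R : K)^-1 *: y ^+ i.
Let fil_seq_exp y : F 1 y -> forall i, F i (seq_exp y i).
Proof. by move=> Fy i; apply: nfilZ; apply: ncF_pow. Qed.

(** With divided powers [mul_pow_commr] becomes a Cauchy product, whose
    truncation is correct up to order N. *)
Lemma mul_texp N y (w : R) : F 1 y -> F 1 w ->
  w * texp N y =[N]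
  texp N y * \sum_(k < N) (k`!%:R : K)^-1 *: iter k (commr y) w.
Proof.
move=> Fy Fw; set t := fun k => (k`!%:R : K)^-1 *: iter k (commr y) w.
have Ft m : F m (t m).
  by apply: nfilZ; apply: (fil_decr fF); apply: ncF_commr.
apply: nsym; rewrite -/(t _).
apply: (ntrans (eval_conv fp N (fil_seq_exp Fy) Ft)).
rewrite /texp mulr_sumr /eval_series.
rewrite [X in congF _ _ _ X](eq_bigr (fun n : 'I_N => conv *%R (seq_exp y) t n)).
  exact: nrefl.
move=> n _; rewrite -scalerAr mul_pow_commr scaler_sumr; apply: eq_bigr => i _.
rewrite /seq_exp /t -scalerAl -scalerAr scalerA -bin_fact_inv ?leq_ord //.
by rewrite -scalerMnr scalerMnl.
Qed.

(** The same for [deriv_pow_commr]; the power n.+1 on the left contributes the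
    terms of index n on the right. *)
Lemma euler_texp N y : F 1 y ->
  euler (texp N.+1 y) =[N]
  texp N y * \sum_(k < N) (k.+1`!%:R : K)^-1 *: iter k (commr y) (euler y).
Proof.
move=> Fy; set t := fun k => (k.+1`!%:R : K)^-1 *: iter k (commr y) (euler y).
have Ft m : F m (t m).
  apply: nfilZ; apply: (fil_decr fF); apply: ncF_commr => //.
  exact: euler_fil.
apply: nsym; rewrite -/(t _).
apply: (ntrans (eval_conv fp N (fil_seq_exp Fy) Ft)).
rewrite /texp (additive_fun_sum _ _ _ (@eulerD K)) big_ord_recl.
rewrite eulerZ expr0 euler1 scaler0 add0r /eval_series.
rewrite [X in congF _ _ _ X](eq_bigr (fun n : 'I_N => conv *%R (seq_exp y) t n)).
  exact: nrefl.
move=> n _; rewrite lift0 eulerZ deriv_pow_commr; [|exact: eulerD|exact: eulerM].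
rewrite scaler_sumr; apply: eq_bigr => i _.
rewrite /seq_exp /t -scalerAl -scalerAr scalerA -subSn ?leq_ord //.
rewrite -bin_fact_inv; last by rewrite ltnW // ltnS leq_ord.
by rewrite -scalerMnr scalerMnl.
Qed.

(** Multiplication by f - 1 gains one order, so that an element killed by f up
    to order N has order k for all k <= N. *)
Lemma cong_cancel N f g h : F 1 (f - 1) -> f * g =[N] f * h -> g =[N] h.
Proof.
move=> Ff; rewrite /congF -mulrBr; move: (g - h) => {g h} g Fg.
suff: forall k, (k <= N)%N -> F k g by apply.
elim=> [_|k IH lt_kN]; first exact: filT.
rewrite -[g](subKr (f * g)); apply: (filB fF); first exact: (fil_le fF lt_kN).
rewrite -{2}[g]mul1r -mulrBl -add1n; apply: nM => //.
exact/IH/ltnW.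
Qed.

End NCExp.

(** * exp (ln (1 + X)) = 1 + X *)

Section ExpLn.
Variable K : fieldType.
Hypothesis charK0 : [pchar K] =i pred0.

Definition ln_poly N : {poly K} :=
  \sum_(m < N) ((-1) ^+ m / m.+1%:R) *: 'X^(m.+1).

Definition exp_ln_poly N : {poly K} :=
  \sum_(n < N) (n`!%:R)^-1 *: ln_poly N ^+ n.

Lemma deriv_ln_poly N : (1 + 'X) * (ln_poly N)^`() = 1 - (- 'X) ^+ N.
Proof.
have -> : (ln_poly N)^`() = \sum_(m < N) (- 'X) ^+ m.
  rewrite /ln_poly raddf_sum; apply: eq_bigr => m _ /=.
  rewrite derivZ derivXn -scaler_nat scalerA -mulrA mulVf ?natK_neq0 // mulr1.
  by rewrite [RHS]exprNn -!(signr_odd _ m); case: odd;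
    rewrite ?expr1 ?expr0 ?scaleN1r ?mulN1r ?scale1r ?mul1r.
by rewrite -[RHS]opprB subrX1 -mulNr opprB opprK.
Qed.

Lemma ln_poly_dvdX N : exists q, ln_poly N = q * 'X.
Proof.
exists (\sum_(m < N) ((-1) ^+ m / m.+1%:R) *: 'X^m); rewrite mulr_suml.
by apply: eq_bigr => m _; rewrite -scalerAl exprSr.
Qed.

(** The truncated composite G satisfies G(0) = 1 and, except in high degrees,
    (1 + X) G' = G. *)
Lemma coef_exp_ln_poly N k : (k < N)%N -> (exp_ln_poly N)`_k = (1 + 'X)`_k.
Proof.
case: N => // N; rewrite ltnS.
set l := ln_poly N.+1; set G := exp_ln_poly N.+1.
have [q lE] := ln_poly_dvdX N.+1.
have dG : G^`() = l^`() * (G - (N`!%:R)^-1 *: l ^+ N).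
  rewrite {2}/G /exp_ln_poly big_ord_recr /= addrK mulr_sumr.
  rewrite /G /exp_ln_poly raddf_sum big_ord_recl /= expr0 derivZ derivC scaler0 add0r.
  apply: eq_bigr => n _; rewrite /bump /= add1n derivZ deriv_exp /= -scalerMnr scalerMnl.
  by rewrite scale_factS // -scalerAr.
have dGk i : (i < N)%N -> ((1 + 'X) * G^`())`_i = G`_i.
  move=> lt_iN; rewrite dG mulrA deriv_ln_poly mulrBl mul1r.
  rewrite exprNn -mulrA -commr_polyXn mulrA !coefB coefMXn ltnS (ltnW lt_iN).
  by rewrite subr0 coefZ /l lE exprMn coefMXn lt_iN mulr0 subr0.
have G0 : G`_0 = 1.
  rewrite /G /exp_ln_poly big_ord_recl coefD coefZ expr0 coef1 fact0 invr1 mul1r.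
  rewrite coef_sum big1 ?addr0 // => n _.
  by rewrite coefZ exprSr {2}lE mulrA coefMX mulr0.
have Gk i : (i < N)%N -> G`_i.+1 *+ i.+1 = G`_i - G`_i *+ i.
  move=> lt_iN; have := dGk i lt_iN; rewrite mulrDl mul1r coefD coefXM coef_deriv.
  case: i lt_iN => [|i] lt_iN /= E; first by rewrite -E addr0 mulr0n subr0.
  by rewrite -[X in X - _]E coef_deriv addrK.
have natI n (x y : K) : x *+ n.+1 = y *+ n.+1 -> x = y.
  by rewrite -[LHS]mulr_natr -[RHS]mulr_natr => /mulIf; apply; apply: natK_neq0.
have XE j : (1 + 'X : {poly K})`_j = (j == 0)%:R + (j == 1)%:R.
  by rewrite coefD coef1 coefX.
rewrite XE; elim: k => [|k IH] lt_kN; first by rewrite G0 addr0.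
move: (Gk k lt_kN).
rewrite (IH (ltnW lt_kN)).
move=> E.
apply: (natI k).
rewrite E.
by case: k {IH E lt_kN} => [|[|k]] /=; rewrite ?add0r ?addr0 ?mul0rn ?mulr0n
  ?mulr1n ?subr0 ?subrr ?oppr0.
Qed.

Lemma exp_ln_poly_cong N : exists q, exp_ln_poly N = 1 + 'X + q * 'X^N.
Proof.
set p := exp_ln_poly N - (1 + 'X); exists (drop_poly N p).
have -> : drop_poly N p * 'X^N = p.
  rewrite -[RHS](poly_take_drop N) (_ : take_poly N p = 0) ?add0r //.
  apply/polyP => i; rewrite coef_take_poly coef0; case: ltnP => // lt_iN.
  by rewrite coefB coef_exp_ln_poly // subrr.
by rewrite /p addrC subrK.
Qed.

(** Up to order N this is ln (1 + f), see [nc_ln_cong]. *)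
Definition tln N (f : ncs K) : ncs K :=
  \sum_(m < N) ((-1) ^+ m / m.+1%:R) *: f ^+ m.+1.

Lemma texp_tln N (f : ncs K) : ncF 1 f ->
  congF (@ncF K) N (texp N (tln N f)) (1 + f).
Proof.
move=> Ff; have [q] := exp_ln_poly_cong N.
have hZ (c : K) p : horner_alg f (c *: p) = c *: horner_alg f p.
  by rewrite -mul_polyC [LHS]rmorphM [X in X * _]horner_algC mulr_algl.
have hlE : horner_alg f (ln_poly N) = tln N f.
  rewrite /ln_poly raddf_sum; apply: eq_bigr => m _.
  by rewrite [LHS]hZ rmorphXn; congr (_ *: _ ^+ _); apply: horner_algX.
have hE : horner_alg f (exp_ln_poly N) = texp N (tln N f).
  rewrite /exp_ln_poly raddf_sum; apply: eq_bigr => n _.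
  by rewrite [LHS]hZ rmorphXn -hlE.
move=> /(congr1 (horner_alg f)); rewrite hE => ->.
rewrite !rmorphD rmorph1 rmorphM rmorphXn /= horner_algX /congF addrAC subrr add0r.
by rewrite -[N]add0n; apply: (fp_st (ncF_prelie K)) => //; apply: ncF_pow.
Qed.

End ExpLn.

(** * The Baker-Campbell-Hausdorff theorem *)

Section BCHLie.
Variable K : fieldType.
Hypothesis charK0 : [pchar K] =i pred0.
Local Notation R := (ncs K).
Local Notation F := (@ncF K).
Implicit Types (f g h y z : R) (w : seq bool).
Local Notation "x =[ k ] y" := (congF F k x y) (at level 70, k at level 0).

Let fp := ncF_prelie K.
Let fF : filtration F := fp_fil fp.
Let nrefl N f : f =[N] f. Proof. exact: (cong_refl fF N f). Qed.
Let nsym N f g : f =[N] g -> g =[N] f. Proof. exact: (@cong_sym _ _ _ fF). Qed.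
Let ntrans N f g h : f =[N] g -> g =[N] h -> f =[N] h.
Proof. exact: (@cong_trans _ _ _ fF). Qed.
Let nZ N (c : K) f g : f =[N] g -> c *: f =[N] c *: g.
Proof. exact: (@congZ _ _ _ fF). Qed.
Let nD N f f' g g' : f =[N] f' -> g =[N] g' -> f + g =[N] f' + g'.
Proof. exact: (@congD _ _ _ fF). Qed.
Let nN N f g : f =[N] g -> - f =[N] - g.
Proof. exact: (@congN _ _ _ fF). Qed.
Let nle k l f g : (k <= l)%N -> f =[l] g -> f =[k] g.
Proof. exact: (@cong_le _ _ _ fF). Qed.
Let nM k l f g : F k f -> F l g -> F (k + l)%N (f * g).
Proof. exact: (fp_st fp). Qed.

Let X : R := nc_var K false.
Let Y : R := nc_var K true.
Let eX : R := nc_exp X.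
Let eY : R := nc_exp Y.
Let Z : R := bch_series K.

Let FX : F 1 X. Proof. exact/ncF1. Qed.
Let FY : F 1 Y. Proof. exact/ncF1. Qed.

Let nc_exp_nil f : (nc_exp f : R) [::] = 1.
Proof. by rewrite /nc_exp big_nat1 fact0 invr1 mul1r. Qed.

Lemma nc_ln_cong N f : F 1 (f - 1) -> (nc_ln f : R) =[N] tln N (f - 1).
Proof.
move=> Ff; apply: word_cong => w lt_w; rewrite /nc_ln /tln nc_sumE big_add1 /=.
rewrite -[RHS](big_mkord xpredT
  (fun n => ((-1) ^+ n / n.+1%:R) * ((f - 1) ^+ n.+1 : R) w)).
rewrite [RHS](@big_cat_nat _ _ _ (size w)) //= ?(ltnW lt_w) //.
rewrite [X in _ + X]big_nat_cond [X in _ + X]big1 ?addr0 => [|n].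
  apply: eq_bigr => n _; rewrite exprS -nc_powE.
  by [].
by case/andP=> /andP[le_wn _] _; rewrite ncF_pow ?mulr0.
Qed.

Let FP : F 1 (eX * eY - 1).
Proof.
apply/ncF1; rewrite -[LHS]/(nc_mul eX eY [::] - 1).
by rewrite nc_mul_nil /eX /eY !nc_exp_nil mulr1 subrr.
Qed.

Lemma bch_series_nil : Z [::] = 0.
Proof. by rewrite /Z /bch_series /nc_ln big_geq. Qed.

Lemma texp_bch N : texp N Z =[N] eX * eY.
Proof.
have E : Z =[N] tln N (eX * eY - 1) := nc_ln_cong FP.
apply: (ntrans (texp_cong E)).
by rewrite -[X in _ =[_] X](subrKC 1); apply: texp_tln.
Qed.

Let FZ : F 1 Z. Proof. exact/ncF1/bch_series_nil. Qed.

(** Both sides of e^Z = e^X e^Y have the same image under the Euler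
    derivation; this expresses the Euler derivative of Z in terms of brackets
    with Z, in which the parts of Z of lower degree suffice. *)
Lemma euler_bch N :
  \sum_(k < N) (k.+1`!%:R : K)^-1 *: iter k (commr Z) (euler Z) =[N]
  Y + \sum_(k < N) (k`!%:R : K)^-1 *: iter k (commr Y) X.
Proof.
apply: (cong_cancel FP).
have eulerP M f g : f =[M] g -> euler f =[M] euler g.
  move=> fg; rewrite /congF -(additive_funB _ _ (@eulerD K)).
  exact: euler_fil.
have euler_expvar b :
    euler (nc_exp (nc_var K b) : R) =[N] (nc_exp (nc_var K b) : R) * nc_var K b.
  have Fb : F 1 (nc_var K b : R) by apply/ncF1.
  have comm0 k : iter k.+1 (commr (nc_var K b : R)) (nc_var K b) = 0.
    elim: k => [|k IH]; first exact: subrr.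
    by rewrite iterS IH /commr mul0r mulr0 subrr.
  have step := eulerP _ _ _ (nc_exp_cong (N := N.+1) Fb).
  apply: (ntrans (nle (leqnSn N) step)).
  apply: (ntrans (euler_texp charK0 (N := N) Fb)).
  rewrite euler_var; clear step; case: N => [|N]; first exact: filT.
  rewrite [X in _ * X =[_] _]big_ord_recl [X in _ * (_ + X) =[_] _]big1 => [|k _].
    rewrite /= (erefl : 1`! = 1%N) invr1 scale1r addr0; apply: congM => //.
    exact/nsym/nc_exp_cong.
  by rewrite lift0 comm0 scaler0.
have := eulerP _ _ _ (texp_bch (N := N.+1)) => /(nle (leqnSn N)) E.
have := ntrans (nsym (euler_texp charK0 (N := N) FZ)) E => {}E.
set S := \sum_(k < N) (k.+1`!%:R : K)^-1 *: iter k (commr Z) (euler Z) in E *.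
have E' : eX * eY * S =[N] texp N Z * S.
  by apply: congM; first exact/nsym/texp_bch.
apply: (ntrans E').
apply: (ntrans E); rewrite eulerM mulrDr [X in _ =[_] X]addrC.
apply: nD.
  have E1 : euler eX * eY =[N] eX * X * eY.
    by apply: congM => //; apply: euler_expvar.
  apply: (ntrans E1); rewrite -!mulrA; apply: congM => //.
  have E2 : X * eY =[N] X * texp N Y.
    by apply: congM => //; apply: nc_exp_cong.
  apply: (ntrans E2); apply: (ntrans (mul_texp charK0 (N := N) FY FX)).
  by apply: congM => //; apply/nsym/nc_exp_cong.
rewrite -mulrA; apply: congM => //.
exact: euler_expvar.
Qed.

Definition lie_comb (p : seq (K * lie_monomial)) : R :=
  \sum_(ct <- p) ct.1 *: (lie_expand K ct.2 : R).

Definition lie_poly f : Prop := exists p, f = lie_comb p.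

Lemma lie_poly0 : lie_poly 0.
Proof. by exists [::]; rewrite /lie_comb big_nil. Qed.

Lemma lie_polyD f g : lie_poly f -> lie_poly g -> lie_poly (f + g).
Proof.
by case=> p -> [q ->]; exists (p ++ q); rewrite /lie_comb big_cat.
Qed.

Lemma lie_polyZ (c : K) f : lie_poly f -> lie_poly (c *: f).
Proof.
case=> p ->; exists [seq (c * ct.1, ct.2) | ct <- p].
by rewrite /lie_comb big_map scaler_sumr; apply: eq_bigr => ct _; rewrite scalerA.
Qed.

Lemma lie_poly_sum (I : Type) (r : seq I) (P : pred I) (u : I -> R) :
  (forall i, P i -> lie_poly (u i)) -> lie_poly (\sum_(i <- r | P i) u i).
Proof. by apply: big_ind; [exact: lie_poly0 | exact: lie_polyD]. Qed.

Lemma lie_poly_monomial t : lie_poly (lie_expand K t).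
Proof. by exists [:: (1, t)]; rewrite /lie_comb big_seq1 scale1r. Qed.

Lemma lie_poly_commr f g : lie_poly f -> lie_poly g -> lie_poly (commr f g).
Proof.
case=> p -> [q ->].
have -> : commr (lie_comb p) (lie_comb q) = \sum_(ct <- q) \sum_(ds <- p)
    (ct.1 * ds.1) *: (lie_expand K (LieBr ct.2 ds.2) : R).
  rewrite /commr /lie_comb mulr_suml mulr_sumr -sumrB; apply: eq_bigr => ct _.
  rewrite mulr_suml mulr_sumr -sumrB; apply: eq_bigr => ds _.
  rewrite -!scalerAl -!scalerAr !scalerA [ds.1 * _]mulrC -scalerBr.
  by [].
by do 2!apply: lie_poly_sum => ? _; apply/lie_polyZ/lie_poly_monomial.
Qed.

Lemma euler_lie_expand t :
  euler (lie_expand K t : R) = (lie_deg t)%:R *: (lie_expand K t : R).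
Proof.
elim: t => [b|s IHs t IHt]; first by rewrite scale1r; apply: euler_var.
rewrite -[lie_expand K _]/(commr (lie_expand K t : R) (lie_expand K s)).
rewrite /commr (additive_funB _ _ (@eulerD K)) !eulerM IHs IHt /= natrD.
rewrite -!scalerAl -!scalerAr -!scalerDl.
by rewrite [(lie_deg t)%:R + _]addrC -scalerBr.
Qed.

(** An eigenvector of the Euler derivation is homogeneous in characteristic 0. *)
Lemma lie_expand_homog t w : size w != lie_deg t -> lie_expand K t w = 0.
Proof.
move=> ne; have /(congr1 (fun f : R => f w)) := euler_lie_expand t.
rewrite -[LHS]/(_ * _) -[RHS]/(_ * _) => /eqP; rewrite -subr_eq0 -mulrBl mulf_eq0.
case/orP=> [|/eqP //]; rewrite subr_eq0 => /eqP E; case/eqP: ne.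
have inj m n : (m <= n)%N -> m%:R = n%:R :> K -> m = n.
  move=> le_mn /eqP; rewrite eq_sym -subr_eq0 -natrB // ((pcharf0P K).1 charK0).
  by rewrite subn_eq0 => le_nm; apply/eqP; rewrite eqn_leq le_mn.
by case: (leqP (size w) (lie_deg t)) => [le|/ltnW le]; [|apply: esym]; apply: inj.
Qed.

Lemma lie_deg_gt0 t : (0 < lie_deg t)%N.
Proof. by elim: t => //= s IHs t _; rewrite ltn_addr. Qed.

Lemma ncF_lie_expand t : F (lie_deg t) (lie_expand K t).
Proof. by move=> w lt_w; apply: lie_expand_homog; rewrite ltn_eqF. Qed.

Lemma ncF_lie_poly f : lie_poly f -> F 1 f.
Proof.
case=> p ->; apply: (fil_sum _ fF) => ct _; apply: (filZ _ fF).
apply: (fil_le fF (lie_deg_gt0 ct.2)); exact: ncF_lie_expand.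
Qed.

Lemma lie_poly_euler f : lie_poly f -> lie_poly (euler f).
Proof.
case=> p ->; rewrite (additive_fun_sum _ _ _ (@eulerD K)).
apply: lie_poly_sum => ct _; rewrite eulerZ euler_lie_expand.
exact/lie_polyZ/lie_polyZ/lie_poly_monomial.
Qed.

Lemma lie_poly_euler_inv f : lie_poly f -> exists2 g, lie_poly g & euler g = f.
Proof.
case=> p ->; exists (\sum_(ct <- p) (ct.1 / (lie_deg ct.2)%:R) *: (lie_expand K ct.2 : R)).
  by apply: lie_poly_sum => ct _; apply/lie_polyZ/lie_poly_monomial.
rewrite (additive_fun_sum _ _ _ (@eulerD K)); apply: eq_bigr => ct _.
rewrite eulerZ euler_lie_expand scalerA divfK //.
by have := lie_deg_gt0 ct.2; case: (lie_deg ct.2) => // n _; apply: natK_neq0.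
Qed.

Definition lie_upto N f : Prop := exists2 g, lie_poly g & f =[N] g.

Lemma lie_uptoD N f g : lie_upto N f -> lie_upto N g -> lie_upto N (f + g).
Proof.
by case=> f' Lf ff [g' Lg gg]; exists (f' + g'); [apply: lie_polyD | apply: nD].
Qed.

Lemma lie_uptoZ N (c : K) f : lie_upto N f -> lie_upto N (c *: f).
Proof.
by case=> f' Lf ff; exists (c *: f'); [apply: lie_polyZ | apply: nZ].
Qed.

Lemma lie_upto_sum N (I : Type) (r : seq I) (P : pred I) (u : I -> R) :
  (forall i, P i -> lie_upto N (u i)) -> lie_upto N (\sum_(i <- r | P i) u i).
Proof.
apply: big_ind; last exact: lie_uptoD.
by exists 0 => //; apply: lie_poly0.
Qed.

Lemma lie_upto_commr N f g : F 1 f -> F 1 g ->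
  lie_upto N f -> lie_upto N g -> lie_upto N.+1 (commr f g).
Proof.
move=> Ff Fg [f' Lf ff] [g' Lg gg]; exists (commr f' g').
  exact: lie_poly_commr.
have mulP a b a' b' : F 1 b -> F 1 a' -> a =[N] a' -> b =[N] b' ->
    a * b =[N.+1] a' * b'.
  move=> Fb Fa aa bb; rewrite /congF.
  have -> : a * b - a' * b' = (a - a') * b + a' * (b - b').
    by rewrite mulrBl mulrBr addrA subrK.
  apply: (filD fF); first by rewrite -addn1; apply: nM.
  by rewrite -add1n; apply: nM.
by apply: nD; last apply: nN; apply: mulP => //; apply: ncF_lie_poly.
Qed.

(** By induction on the order: brackets of series of order at least 1 gain
    one order of precision over their arguments. *)
Lemma bch_lie_upto N : lie_upto N Z.
Proof.
elim: N => [|N IH]; first by exists 0; [exact: lie_poly0 | exact: filT].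
have FEZ : F 1 (euler Z) by apply: euler_fil.
have [Z' LZ' ZZ] := IH.
have LEZ : lie_upto N (euler Z).
  exists (euler Z'); first exact: lie_poly_euler.
  by rewrite /congF -(additive_funB _ _ (@eulerD K)); apply: euler_fil.
have Lk k : lie_upto N.+1 (iter k.+1 (commr Z) (euler Z)).
  elim: k => [|k [g Lg gg]]; first exact: lie_upto_commr.
  apply: lie_upto_commr => //; last first.
  - by exists g => //; apply: nle gg.
  - exact: (fil_le fF (ltn0Sn k.+1) (ncF_commr (n := k.+1) FZ FEZ)).
have [g Lg gg] : lie_upto N.+1 (euler Z).
  have := euler_bch (N := N.+1); rewrite big_ord_recl /= (erefl : 1`! = 1%N) invr1 scale1r.
  set S := \sum_(i < N) _; set T := \sum_(i < N.+1) _ => E.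
  have L : lie_upto N.+1 (Y + T + (-1) *: S).
    apply: lie_uptoD; last first.
      by apply/lie_uptoZ/lie_upto_sum => k _; apply/lie_uptoZ/Lk.
    exists (Y + T) => //; apply: lie_polyD; first exact: (lie_poly_monomial (LieVar true)).
    apply: lie_poly_sum => k _; apply: lie_polyZ; elim: (nat_of_ord k) => [|j Lj].
      exact: (lie_poly_monomial (LieVar false)).
    by apply: lie_poly_commr => //; exact: (lie_poly_monomial (LieVar true)).
  case: L => g Lg gg; exists g => //; apply: ntrans gg.
  by rewrite scaleN1r -[euler Z](addrK S); apply: nD.
have [h Lh hE] := lie_poly_euler_inv Lg; exists h => //.
apply: word_cong => -[|a w] lt_w.
  by rewrite [LHS]FZ // [RHS](ncF_lie_poly Lh).
have := cong_word gg lt_w; rewrite -hE => /mulfI; apply.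
exact: natK_neq0.
Qed.

(** An expression that is correct up to order n+1 is restricted to its monomials
    of degree n. *)
Theorem bch_part_lie n : exists p : seq (K * lie_monomial),
  all (fun ct => lie_deg ct.2 == n) p /\
  (forall w, size w = n ->
    \sum_(ct <- p) ct.1 * lie_expand K ct.2 w = bch_series K w).
Proof.
have [_ [p ->] E] := bch_lie_upto n.+1.
exists [seq ct <- p | lie_deg ct.2 == n]; split; first exact: filter_all.
move=> w wn; have lt_w : (size w < n.+1)%N by rewrite wn.
rewrite -[RHS]/(Z w) (cong_word E lt_w) /lie_comb nc_sumE big_filter [LHS]big_mkcond.
apply: eq_bigr => ct _; case: ifP => // /negbT ne.
by rewrite -[RHS]/(_ * _) lie_expand_homog ?mulr0 // wn eq_sym.
Qed.

End BCHLie.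

(** * The action of noncommutative series by right multiplications *)

Section Action.
Variables (K : fieldType) (V : lmodType K) (F : nat -> set V).
Variables (st : V -> V -> V) (e : V).
Hypothesis charK0 : [pchar K] =i pred0.
Hypothesis fp : filtered_prelie F st e.
Hypothesis cF : fcomplete F.
Local Notation "x =[ k ] y" := (congF F k x y) (at level 70, k at level 0).
Local Notation R := (ncs K).
Implicit Types (f g : R) (a : V).

Let fF : filtration F := fp_fil fp.

Let ncrefl N f : congF (@ncF K) N f f.
Proof. exact: (cong_refl (fp_fil (ncF_prelie K)) N f). Qed.

Variables x y : V.
Hypotheses (Fx : F 1 x) (Fy : F 1 y).

Let var (b : bool) := if b then y else x.

Let Fvar b : F 1 (var b). Proof. by case: b. Qed.

(** The right module structure given by right multiplications, truncated to
    words of length less than N. The first letter acts first, so that products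
    of series act as composites in the order in which they are written
    ([wact_mul]). *)
Fixpoint wact N f a : V :=
  if N is M.+1 then
    f [::] *: a + \sum_(b : bool) wact M (lquo b f) (st a (var b))
  else 0.

Lemma wactE N f a : wact N.+1 f a =
  f [::] *: a + \sum_(b : bool) wact N (lquo b f) (st a (var b)).
Proof. by []. Qed.

Lemma wact_fil N f k a : F k a -> F k (wact N f a).
Proof.
elim: N f k a => [|N IH] f k a Fa /=; first exact: fil0.
apply: (filD fF); first exact: filZ.
apply: (fil_sum _ fF) => b _; apply: IH; rewrite -[k]addn0.
by apply: (fp_st fp) => //; apply: filT.
Qed.

Lemma wact_linr N f (c : K) a a' :
  wact N f (c *: a + a') = c *: wact N f a + wact N f a'.
Proof.
elim: N f a a' => [|N IH] f a a' /=; first by rewrite scaler0 addr0.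
rewrite scalerDr !scalerA [f _ * _]mulrC !scalerDr scaler_sumr !scalerA addrACA.
rewrite -big_split; congr (_ + _); apply: eq_bigr => b _.
by rewrite (fp_linl fp) IH.
Qed.

Lemma wact_linl N (c : K) f g a :
  wact N (c *: f + g) a = c *: wact N f a + wact N g a.
Proof.
elim: N f g a => [|N IH] f g a /=; first by rewrite scaler0 addr0.
rewrite scalerDr scaler_sumr addrACA -big_split; congr (_ + _).
  by rewrite scalerA -scalerDl.
by apply: eq_bigr => b _; apply: (IH (lquo b f)).
Qed.

Lemma wact0 N a : wact N 0 a = 0.
Proof. by have := wact_linl N (-1) 0 0 a; rewrite scaler0 addr0 scaleN1r addNr. Qed.

Lemma wactDr N f : additive_fun (wact N f).
Proof. by move=> a a'; have := wact_linr N f 1 a a'; rewrite !scale1r. Qed.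

Lemma wactZr N f c a : wact N f (c *: a) = c *: wact N f a.
Proof.
have := wact_linr N f c a 0; rewrite !addr0 => ->.
by rewrite (additive_fun0 (@wactDr N f)) addr0.
Qed.

Lemma wactD N f g a : wact N (f + g) a = wact N f a + wact N g a.
Proof. by have := wact_linl N 1 f g a; rewrite !scale1r. Qed.

Lemma wactZ N c f a : wact N (c *: f) a = c *: wact N f a.
Proof. by have := wact_linl N c f 0 a; rewrite !addr0 wact0 addr0. Qed.

Lemma wact_sum N (I : Type) (r : seq I) (P : pred I) (u : I -> R) a :
  wact N (\sum_(i <- r | P i) u i) a = \sum_(i <- r | P i) wact N (u i) a.
Proof.
by apply: (big_morph (fun f => wact N f a)) => [f g|]; [exact: wactD | exact: wact0].
Qed.

Lemma wact_cong N f f' a a' : congF (@ncF K) N f f' -> a =[N] a' ->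
  wact N f a =[N] wact N f' a'.
Proof.
move=> ff aa; have -> : wact N f a = wact N f' a.
  elim: N f f' a ff {aa} => //= N IH f f' a ff; rewrite (cong_word ff) //.
  congr (_ + _); apply: eq_bigr => b _; apply: IH => w lt_w.
  exact: (ff (b :: w)).
by rewrite /congF -(additive_funB _ _ (@wactDr N f')); apply: wact_fil.
Qed.

Lemma wactS N f k a : F k a -> wact N.+1 f a =[(N + k)] wact N f a.
Proof.
elim: N f k a => [|N IH] f k a Fa.
  by rewrite /congF subr0; apply: wact_fil.
rewrite !wactE; apply: congD => //; first exact: (cong_refl fF).
apply: cong_sum => // b _; rewrite addSnnS; apply: IH.
by rewrite -addn1; apply: (fp_st fp).
Qed.

(** The induction on words needs the precision N + k for arguments in F_k, as
    each letter read raises the filtration by one. *)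
Lemma wact_mul_fil N f g k a : F k a ->
  wact N (f * g) a =[(N + k)] wact N g (wact N f a).
Proof.
elim: N f k a => [|N IH] f k a Fa.
  by rewrite /congF subrr; apply: fil0.
set u := wact N.+1 f a.
have -> : wact N.+1 (f * g) a = f [::] *: wact N.+1 g a
    + \sum_b wact N (lquo b f * g) (st a (var b)).
  rewrite /= -[(f * g) [::]]/(nc_mul f g [::]) nc_mul_nil scalerDr scalerA.
  rewrite -addrA scaler_sumr -big_split; congr (_ + _); apply: eq_bigr => b _.
  by rewrite -[lquo b (f * g)]/(lquo b (nc_mul f g)) lquo_mul wactD wactZ.
rewrite /u [wact N.+1 f a]wactE wactDr wactZr.
apply: congD => //; first exact: (cong_refl fF).
rewrite (additive_fun_sum _ _ _ (@wactDr _ g)); apply: cong_sum => // b _.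
have Fab : F k.+1 (st a (var b)) by rewrite -addn1; apply: (fp_st fp).
rewrite addSnnS; apply: (cong_trans fF (IH _ _ _ Fab)).
by apply: cong_sym => //; apply: wactS; apply: wact_fil.
Qed.

Lemma wact_mul N f g a : wact N (f * g) a =[N] wact N g (wact N f a).
Proof.
by have := @wact_mul_fil N f g 0 a; rewrite addn0; apply; apply: filT.
Qed.

Lemma wact1 N a : wact N.+1 1 a = a.
Proof.
rewrite wactE -[(1 : R) [::]]/(1 : K) scale1r big1 ?addr0 // => b _.
exact: wact0.
Qed.

Lemma wact_var N b a : wact N (nc_var K b) a =[N] st a (var b).
Proof.
case: N => [|[|N]]; first exact: filT.
  rewrite /= big1 // -[nc_var _ _ _]/(0 : K) scale0r addr0.
  apply: cong_sym => //; apply: cong0; rewrite -[1%N]add0n.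
  by apply: (fp_st fp) => //; apply: filT.
rewrite wactE -[nc_var _ _ [::]]/(0 : K) scale0r add0r (bigD1 b) //.
have lquo_var b' : lquo b' (nc_var K b) = if b' == b then 1 else 0.
  by apply/funext => w; rewrite /lquo /nc_var eqseq_cons; case: eqP.
rewrite big1 ?addr0 => [|b' nb]; last first.
  by rewrite lquo_var (negPf nb) wact0.
by rewrite lquo_var eqxx wact1 [X in X =[_] _]addr0; apply: (cong_refl fF).
Qed.

Definition st_br (u v : V) := st u v - st v u.

(** Right multiplication is an anti-representation of the Lie bracket, by right
    symmetry; so a Lie monomial and its expansion act in the same way. *)
Lemma wact_lie N t a :
  wact N (lie_expand K t) a =[N] st a (lie_eval st_br x y t).
Proof.
elim: t a => [b|s IHs t IHt] a; first exact: wact_var.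
rewrite -[lie_expand K _]/((lie_expand K s : R) * (lie_expand K t : R)
  - (lie_expand K t : R) * (lie_expand K s : R)).
rewrite wactD -scaleN1r wactZ scaleN1r /=; set u := lie_eval _ _ _ s.
set v := lie_eval _ _ _ t.
have -> : st a (st_br u v) = st (st a u) v - st (st a v) u.
  rewrite /st_br (additive_funB _ _ (st_addr fp a)).
  have /eqP := fp_rsym fp a u v; rewrite subr_eq => /eqP ->.
  by rewrite -(addrA (st (st a v) u)) [RHS]addrC addKr addrC.
apply: congD => //; last apply: congN => //.
  apply: (cong_trans fF (wact_mul _ _ _ _)).
  by apply: (cong_trans fF) (IHt _); apply: wact_cong (IHs _); apply: ncrefl.
apply: (cong_trans fF (wact_mul _ _ _ _)).
by apply: (cong_trans fF) (IHs _); apply: wact_cong (IHt _); apply: ncrefl.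
Qed.


Lemma iter_cong N u u' n a a' : u =[N] u' -> a =[N] a' ->
  iter n (st^~ u) a =[N] iter n (st^~ u') a'.
Proof. by move=> uu aa; elim: n => //= n IH; apply: (cong_st fp). Qed.

(** By [wact_mul] the powers of f act as the iterates of the right
    multiplication by u. *)
Lemma wact_texp N f u a : (forall b, wact N f b =[N] st b u) ->
  wact N (texp N f) a =[N] rexp st N u a.
Proof.
move=> fu; rewrite /texp wact_sum; apply: cong_sum => // n _.
rewrite wactZ; apply: congZ => //; elim: (nat_of_ord n) a => [|m IH] a.
  case: N {fu n} => [|N]; first exact: filT.
  by rewrite wact1; apply: (cong_refl fF).
rewrite exprS iterSr; apply: (cong_trans fF (wact_mul _ _ _ _)).
by apply: (cong_trans fF) (IH _); apply: wact_cong => //; apply: ncrefl.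
Qed.

Let bch_xy := fsum F (fun n => bch_part st_br n.+1 x y).

Lemma fil_lie_monomial t : F (lie_deg t) (lie_eval st_br x y t).
Proof.
elim: t => [b|s IHs t IHt] /=; first exact: Fvar.
by apply: (filB fF); [|rewrite addnC]; apply: (fp_st fp).
Qed.

(** Right multiplication by BCH(x, y) is the action of ln (e^X e^Y). As right
    multiplications determine an element, the chosen expressions of the
    homogeneous parts by brackets do not matter. *)
Lemma wact_bch N a : wact N (bch_series K) a =[N] st a bch_xy.
Proof.
have /choice [p pP] n : exists p : seq (K * lie_monomial),
    [/\ all (fun ct => lie_deg ct.2 == n.+1) p,
        forall w, size w = n.+1 ->
          \sum_(ct <- p) ct.1 * lie_expand K ct.2 w = bch_series K w
      & bch_part st_br n.+1 x y
        = \sum_(ct <- p) ct.1 *: lie_eval st_br x y ct.2].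
  rewrite /bch_part; case: xgetP => [z' _ [q]|no]; first by exists q.
  have [q [q1 q2]] := bch_part_lie charK0 n.+1.
  by case: (no (\sum_(ct <- q) ct.1 *: lie_eval st_br x y ct.2)); exists q.
have zE : bch_xy =[N] \sum_(n < N) \sum_(ct <- p n) ct.1 *: lie_eval st_br x y ct.2.
  rewrite (eq_bigr (fun n : 'I_N => bch_part st_br n.+1 x y)) => [|n _]; last first.
    by have [] := pP n.
  apply: fsum_cong => // n; have [pn _ ->] := pP n.
  apply: (fil_decr fF); rewrite -(all_filterP pn) big_filter.
  apply: (fil_sum _ fF) => ct /eqP <-.
  by apply: (filZ _ fF); apply: fil_lie_monomial.
have bE : congF (@ncF K) N (bch_series K)
    (\sum_(n < N) \sum_(ct <- p n) ct.1 *: (lie_expand K ct.2 : R)).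
  apply: word_cong => w lt_w; rewrite nc_sumE.
  under eq_bigr do rewrite nc_sumE.
  have homog n : size w != n.+1 ->
      \sum_(ct <- p n) (ct.1 *: (lie_expand K ct.2 : R)) w = 0.
    have [/all_filterP <- _ _] := pP n; rewrite big_filter => ne.
    apply: big1 => ct /eqP E.
    by rewrite -[LHS]/(_ * _) lie_expand_homog ?mulr0 // E.
  case: w lt_w homog => [_|b w lt_w] homog.
    by rewrite big1 ?bch_series_nil // => n _; apply: homog.
  rewrite (bigD1 (Ordinal (ltnW lt_w))) //= [X in _ + X]big1 ?addr0 => [|n nw].
    by have [_ /(_ (b :: w) erefl) <- _] := pP (size w).
  by apply: homog; rewrite eqSS eq_sym.
apply: (cong_trans fF (wact_cong bE (cong_refl fF N a))).
apply: (cong_trans fF) (cong_st fp (cong_refl fF N a) (cong_sym fF zE)).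
rewrite wact_sum (additive_fun_sum _ _ _ (st_addr fp a)).
apply: (cong_sum fF) => n _.
rewrite wact_sum (additive_fun_sum _ _ _ (st_addr fp a)).
apply: (cong_sum fF) => ct _.
by rewrite wactZ (st_scaler fp); apply: congZ => //; apply: wact_lie.
Qed.

(** In each of the three exponentials, a series acts as a right multiplication;
    the order of x and y is reversed as the first letter acts first. *)
Theorem rexp_bch N a : rexp st N bch_xy a =[N] rexp st N y (rexp st N x a).
Proof.
have rX b c : wact N (nc_exp (nc_var K b)) c =[N] rexp st N (var b) c.
  have Fb : ncF 1 (nc_var K b : R) by apply/ncF1.
  apply: (cong_trans fF (wact_cong (nc_exp_cong (N := N) Fb) (cong_refl fF N c))).
  by apply: wact_texp => c'; apply: wact_var.
have E := wact_texp a (@wact_bch N); apply: (cong_trans fF (cong_sym fF E)).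
apply: (cong_trans fF (wact_cong (texp_bch charK0 (N := N)) (cong_refl fF N a))).
apply: (cong_trans fF (wact_mul _ _ _ _)); apply: (cong_trans fF (rX true _)).
rewrite /rexp; apply: (cong_sum fF) => n _; apply: congZ => //.
exact: iter_cong (cong_refl fF N _) (rX false a).
Qed.

End Action.

(** * Exponentials, circle products and unipotent maps *)

Section Unipotent.
Variables (K : fieldType) (V : lmodType K) (F : nat -> set V).
Hypotheses (fF : filtration F) (cF : fcomplete F).

Variable phi : V -> V.
Hypothesis phi_fil : forall u, F 1 u -> F 1 (phi u).
Hypothesis phi_unip : forall k u v, F 1 u -> F 1 v ->
  F k (u - v) -> F k.+1 (phi u - phi v - (u - v)).

(** In each degree the leading term of u - v is that of phi(u) - phi(v). *)
Lemma unipotent_fil k u v : F 1 u -> F 1 v ->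
  F k (phi u - phi v) -> F k (u - v).
Proof.
move=> Fu Fv; elim: k => [_|k IH Fk]; first exact: filT.
rewrite -[u - v](subKr (phi u - phi v)); apply: (filB fF) => //.
by apply: phi_unip => //; apply/IH/(fil_decr fF).
Qed.

(** Newton-like iteration: the error w - phi(u) gains one degree at each step. *)
Lemma unipotent_surj w : F 1 w -> exists2 u, F 1 u & phi u = w.
Proof.
move=> Fw; pose step u := u + (w - phi u); pose u n := iter n step 0.
pose r n := w - phi (u n).
have uS n : u n.+1 = u n + r n by [].
have uSB n : u n.+1 - u n = r n by rewrite uS addrC addKr.
have [Fu Fr] : (forall n, F 1 (u n)) /\ (forall n, F n.+1 (r n)).
  have H n : F 1 (u n) /\ F n.+1 (r n).
    elim: n => [|n [Fu Fr]].
      have F0 := fil0 fF 1; split=> //; apply: (filB fF) => //; exact: phi_fil.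
    have FuS : F 1 (u n.+1).
      by rewrite uS; apply: (filD fF) => //; apply: (fil_le fF (ltn0Sn n)).
    split=> //; have -> : r n.+1 = - (phi (u n.+1) - phi (u n) - (u n.+1 - u n)).
      by rewrite uSB opprB /r [- (_ - phi (u n))]opprB subrKA.
    by apply: (filN fF); apply: phi_unip => //; rewrite uSB.
  by split=> n; have [] := H n.
pose l := fsum F r.
have uE n : u n = \sum_(i < n) r i.
  by elim: n => [|n IH]; rewrite ?big_ord0 // big_ord_recr uS -IH.
have lE n : F n (l - u n).
  rewrite uE; apply: fsum_cong => // i; exact: (fil_decr fF).
have Fl : F 1 l by rewrite -[l](subrK (u 1%N)); apply: (filD fF).
exists l => //; apply/esym/(cong_eq fF cF) => k.
have Fk : F k (phi l - phi (u k)).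
  rewrite -[phi l - _](subrK (l - u k)); apply: (filD fF) => //.
  by apply: (fil_decr fF); apply: phi_unip.
rewrite /congF -(subrKA (phi (u k))); apply: (filD fF).
  by apply: (fil_decr fF); apply: Fr.
by rewrite -opprB; apply: (filN fF).
Qed.

End Unipotent.

Section ExpCircle.
Variables (K : fieldType) (V : lmodType K) (F : nat -> set V).
Variables (st : V -> V -> V) (e : V).
Hypothesis charK0 : [pchar K] =i pred0.
Hypothesis fp : filtered_prelie F st e.
Hypothesis cF : fcomplete F.
Local Notation "x =[ k ] y" := (congF F k x y) (at level 70, k at level 0).
Implicit Types (a b l x y : V).

Let fF : filtration F := fp_fil fp.
Let crefl N x : x =[N] x. Proof. exact: (cong_refl fF N x). Qed.
Let csym N x y : x =[N] y -> y =[N] x. Proof. exact: (@cong_sym _ _ _ fF). Qed.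
Let ctrans N x y z : x =[N] y -> y =[N] z -> x =[N] z.
Proof. exact: (@cong_trans _ _ _ fF). Qed.

(** [fexp], [fcirc] and [fbch] are the pre-Lie exponential, the circle product
    and the Baker-Campbell-Hausdorff series of a filtered pre-Lie algebra. *)
Definition fexp l := e + fsum F (fun n => (n.+1`!%:R : K)^-1 *: iter n (st^~ l) l).

Definition fcirc a b :=
  fsum F (fun n => (n`!%:R : K)^-1 *: brace st n a (fun=> b)).

Definition fbch x y := fsum F (fun n => bch_part (st_br st) n.+1 x y).

Lemma fil_iter k l a n : F 1 l -> F k a -> F (k + n)%N (iter n (st^~ l) a).
Proof.
move=> Fl Fa; elim: n => [|n IH]; first by rewrite addn0.
by rewrite iterS addnS -addn1; apply: (fp_st fp).
Qed.

Lemma fexp_cong N l : F 1 l -> fexp l =[N] rexp st N l e.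
Proof.
move=> Fl; case: N => [|N]; first exact: filT.
rewrite /rexp big_ord_recl /= fact0 invr1 scale1r; apply: congD => //.
have Fu n : F n.+1 ((n.+1`!%:R : K)^-1 *: iter n (st^~ l) l).
  by apply: (filZ _ fF); rewrite -add1n; apply: fil_iter.
apply: ctrans (fsum_cong fF cF N.+1 _) _ => [n|]; first exact: (fil_decr fF).
rewrite big_ord_recr /= -[X in _ =[_] X]addr0; apply: (congD fF); last exact: (cong0 (Fu N)).
apply: (cong_sum fF) => n _; rewrite /bump /= add1n.
rewrite -[st (iter n _ e) l]/(iter n.+1 (st^~ l) e) iterSr (fp_unit fp).
exact: crefl.
Qed.

Lemma fil_brace k j n a b : (0 < n)%N ->
  F k a -> F j b -> F 1 b -> F (k + j)%N (brace st n a (fun=> b)).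
Proof.
case: n => // n _ Fa Fb Fb1.
(* One copy of b is counted with weight j, the others with weight 1. *)
pose f i := if i == 0%N then j else 1%N.
have F0B m x y : F m x -> F m y -> F m (x - y) by apply: filB.
have := @brace_fil _ st F (fil0 fF) F0B (fp_st fp) n.+1 k f a (fun=> b) Fa.
rewrite big_ord_recl /= => H; apply: (fil_le fF _ (H _)).
  by rewrite addnA leq_addr.
by move=> i; rewrite /f; case: eqP.
Qed.

Lemma fcirc_cong N a b : F 1 b ->
  fcirc a b =[N] \sum_(n < N) (n`!%:R : K)^-1 *: brace st n a (fun=> b).
Proof.
move=> Fb; apply: fsum_cong => // n; apply: (filZ _ fF).
have F0B m x y : F m x -> F m y -> F m (x - y) by apply: filB.
have := @brace_fil _ st F (fil0 fF) F0B (fp_st fp) n 0 (fun=> 1%N) a (fun=> b).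
by rewrite sum1_card card_ord; apply=> //; apply: filT.
Qed.

Lemma fil_fexp k l : F 1 l -> F k l -> F k (fexp l - e).
Proof.
move=> Fl Fk; rewrite /fexp addrAC subrr add0r.
apply: (cong_fil fF (fsum_cong fF cF k _)) => [n|].
  apply: (filZ _ fF); apply: (fil_decr fF); rewrite -add1n.
  exact: fil_iter.
apply: (fil_sum _ fF) => n _; apply: (filZ _ fF).
exact: (fil_le fF (leq_addr n k) (fil_iter _ Fl Fk)).
Qed.

Lemma fexp_unip k u v : F 1 u -> F 1 v -> F k (u - v) ->
  F k.+1 ((fexp u - e) - (fexp v - e) - (u - v)).
Proof.
move=> Fu Fv Fuv.
have Fq n : F (k + n)%N (iter n (st^~ u) u - iter n (st^~ v) v).
  elim: n => [|n IH]; first by rewrite addn0.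
  have -> : iter n.+1 (st^~ u) u - iter n.+1 (st^~ v) v =
      st (iter n (st^~ u) u - iter n (st^~ v) v) u
      + st (iter n (st^~ v) v) (u - v).
    rewrite (additive_funB _ _ (st_addl fp _)) (additive_funB _ _ (st_addr fp _)).
    by rewrite addrA subrK.
  apply: (filD fF); first by rewrite addnS -addn1; apply: (fp_st fp).
  by rewrite addnC; apply: (fp_st fp) => //; rewrite -add1n; apply: fil_iter.
have E w : F 1 w -> fexp w - e =[k.+1]
    w + \sum_(n < k) (n.+2`!%:R : K)^-1 *: iter n.+1 (st^~ w) w.
  move=> Fw; rewrite /fexp addrAC subrr add0r.
  apply: ctrans (fsum_cong fF cF k.+1 _) _ => [n|].
    apply: (filZ _ fF); apply: (fil_decr fF); rewrite -add1n.
    exact: fil_iter.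
  by rewrite big_ord_recl /= (erefl : 1`! = 1%N) invr1 scale1r; apply: crefl.
have := congD fF (E u Fu) (congN fF (E v Fv)) => Euv.
apply: (cong_fil fF (y := u + \sum_(n < k) (n.+2`!%:R : K)^-1 *: iter n.+1 (st^~ u) u
  - (v + \sum_(n < k) (n.+2`!%:R : K)^-1 *: iter n.+1 (st^~ v) v) - (u - v))).
  by apply: (congD fF).
rewrite [- (v + _)]opprD addrACA [X in F _ X]addrAC subrr add0r -sumrB.
apply: (fil_sum _ fF) => n _.
rewrite -scalerBr; apply: (filZ _ fF).
by apply: (fil_le fF _ (Fq n.+1)); rewrite addnS ltnS leq_addr.
Qed.

(** By [fexp_unip] the map l |-> fexp l - e is unipotent. *)
Lemma fexp_surj b : F 1 b -> exists2 l, F 1 l & fexp l - e = b.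
Proof.
apply: (unipotent_surj fF cF) => [u Fu|]; first exact: fil_fexp.
exact: fexp_unip.
Qed.

Lemma fexp_fil k u v : F 1 u -> F 1 v -> F k (fexp u - fexp v) -> F k (u - v).
Proof.
move=> Fu Fv Fk; apply: (unipotent_fil fF (phi := fun u => fexp u - e)) => //.
  exact: fexp_unip.
by rewrite opprB addrA subrK.
Qed.

Lemma fcirc_fexp N l a : F 1 l -> fcirc a (fexp l - e) =[N] rexp st N l a.
Proof.
move=> Fl; apply: ctrans (fcirc_cong _ _ (fil_fexp Fl Fl)) _.
by apply: (circ_rexp charK0 fp) => //; apply: (congD fF (fexp_cong _ Fl)).
Qed.

Lemma rexp_cong N l a a' : a =[N] a' -> rexp st N l a =[N] rexp st N l a'.
Proof.
move=> aa; apply: (cong_sum fF) => n _; apply: (congZ fF).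
exact: (iter_cong fp).
Qed.

Lemma rexpB N l a a' : rexp st N l (a - a') = rexp st N l a - rexp st N l a'.
Proof.
rewrite /rexp -sumrB; apply: eq_bigr => n _; rewrite -scalerBr; congr (_ *: _).
elim: (nat_of_ord n) => //= m ->; exact: (additive_funB _ _ (st_addl fp l)).
Qed.

(** As e + b is the exponential of some l, the circle product on the right by
    it is the linear operator exp(R_l). *)
Lemma fcircB a a' b : F 1 b -> fcirc (a - a') b = fcirc a b - fcirc a' b.
Proof.
move=> /fexp_surj [l Fl <-]; apply: (cong_eq fF cF) => N.
apply: ctrans (fcirc_fexp _ _ Fl) _; rewrite rexpB; apply: csym.
by apply: (congD fF); last apply: (congN fF); apply: fcirc_fexp.
Qed.

Lemma fcirc_unit b : F 1 b -> fcirc e b = e + b.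
Proof.
move=> /fexp_surj [l Fl <-]; apply: (cong_eq fF cF) => N.
apply: ctrans (fcirc_fexp _ _ Fl) _.
by rewrite addrC subrK; apply/csym/fexp_cong.
Qed.

Lemma fcirc0 a : fcirc a 0 = a.
Proof.
have F10 : F 1 0 := fil0 fF 1; apply: (cong_eq fF cF) => -[|N]; first exact: filT.
apply: ctrans (fcirc_cong _ _ F10) _.
rewrite big_ord_recl /= fact0 invr1 scale1r -[X in _ =[_] X]addr0.
apply: (congD fF) => //; apply: cong0; apply: (fil_sum _ fF) => n _.
apply: (filZ _ fF).
exact: (@fil_brace 0 N.+1 n.+1 a 0 _ (filT fF a) (fil0 fF N.+1) F10).
Qed.

Lemma fcirc_fil k j a b : F k a -> F 1 b -> F j b -> F (k + j)%N (fcirc a b - a).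
Proof.
move=> Fa Fb Fj.
apply: (cong_fil fF (y := \sum_(n < (k + j).+1)
    (n`!%:R : K)^-1 *: brace st n a (fun=> b) - a)).
  apply: (congD fF) => //; apply: (cong_le fF (leqnSn _)); exact: fcirc_cong.
rewrite big_ord_recl /= fact0 invr1 scale1r addrAC subrr add0r.
apply: (fil_sum _ fF) => n _; apply: (filZ _ fF).
exact: (@fil_brace k j n.+1 a b _ Fa Fj Fb).
Qed.

Lemma fil_fcirc k a b : F k a -> F 1 b -> F k (fcirc a b).
Proof.
move=> Fa Fb; rewrite -[fcirc a b](subrK a); apply: (filD fF) => //.
exact: (fil_le fF (leq_addr 1 k) (fcirc_fil Fa Fb Fb)).
Qed.

(** All the circle products here are exponentials of right multiplications,
    which [rexp_bch] composes. *)
Lemma fcirc_fbch x y a : F 1 x -> F 1 y -> F 1 (fbch x y) ->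
  fcirc (fcirc a (fexp x - e)) (fexp y - e) = fcirc a (fexp (fbch x y) - e).
Proof.
move=> Fx Fy Fxy; apply: (cong_eq fF cF) => N.
apply: ctrans (fcirc_fexp _ _ Fy) _.
apply: ctrans (rexp_cong _ (fcirc_fexp _ _ Fx)) _; apply: csym.
by apply: ctrans (fcirc_fexp _ _ Fxy) _; apply: (rexp_bch charK0 fp cF Fx Fy).
Qed.

Lemma fexp_fbch x y : F 1 x -> F 1 y -> F 1 (fbch x y) ->
  fcirc (fexp x) (fexp y - e) = fexp (fbch x y).
Proof.
move=> Fx Fy Fxy; have E l : F 1 l -> fcirc e (fexp l - e) = fexp l.
  by move=> Fl; rewrite fcirc_unit ?subrKC //; apply: fil_fexp.
by rewrite -[fexp x]E // fcirc_fbch // E.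
Qed.

(** Associativity is that of the composition of operators, for b and c written
    as exponentials. *)
Lemma fcircA a b c : (forall x y, F 1 x -> F 1 y -> F 1 (fbch x y)) ->
  F 1 b -> F 1 c ->
  fcirc (fcirc a b) c = fcirc a (fcirc (e + b) c - e).
Proof.
move=> Fbch /fexp_surj [x Fx <-] /fexp_surj [y Fy <-].
by rewrite subrKC fexp_fbch ?fcirc_fbch //; apply: Fbch.
Qed.

(** Left inverses exist as the circle product by e + b is unipotent. *)
Lemma fcirc_inv k b : F 1 b -> F k b ->
  exists a, [/\ F 1 a, F k a & fcirc (e + a) b = e].
Proof.
move=> Fb Fk; pose phi a := fcirc a b.
have phi_unip j u v : F 1 u -> F 1 v -> F j (u - v) ->
    F j.+1 (phi u - phi v - (u - v)).
  by move=> _ _ Fj; rewrite /phi -fcircB // -addn1; apply: fcirc_fil.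
have [||a Fa aE] := @unipotent_surj K V F fF cF phi _ phi_unip (- b).
- by move=> u Fu; apply: fil_fcirc.
- exact: filN.
have phi0 : phi 0 = 0 by rewrite -[X in phi X](subrr 0) /phi fcircB // subrr.
exists a; split=> //.
  rewrite -[a]subr0; apply: (unipotent_fil fF phi_unip) => //; first exact: fil0.
  by rewrite phi0 subr0 aE; apply: filN.
have -> : e + a = e - - a by rewrite opprK.
rewrite fcircB // fcirc_unit // -[- a]sub0r fcircB // -/(phi 0) phi0 sub0r opprK.
by rewrite -[fcirc a b]/(phi a) aE addrK.
Qed.

End ExpCircle.

(** * The degree 0 part of a complete unital dg pre-Lie algebra *)

Section DegreeZero.
Variables (K : fieldType) (A : complete_unital_dg_prelie K).
Local Notation V := (A 0).
Local Notation F0 := (fun k => @F K A k 0).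
Local Notation st := (@star0 K A).
Local Notation e := (Defs.one A).
Local Notation hom0 a := (@Defs.Hom K A 0 a).

Lemma star0E (a b : V) : star0 a b = star a b :> V.
Proof. exact: (@in_degE K A 0 (star a b)). Qed.

Lemma star0_prelie : filtered_prelie F0 st e.
Proof.
split.
- exact: F_filtration.
- by move=> c x a b; rewrite !star0E; apply: (@star_linl K A 0 0 c x a b).
- by move=> c x a b; rewrite !star0E; apply: (@star_linr K A 0 0 c x a b).
- exact: fil_star0.
- move=> a b c; rewrite !star0E.
  have := star_prelie (hom0 a) (hom0 b) (hom0 c).
  have L u v w : in_deg (0 + 0 + 0) (hstar (@star K A)
      (hstar (@star K A) (hom0 u) (hom0 v)) (hom0 w)) = star (star u v) w.
    exact: (@in_degE K A 0).
  have R u v w : in_deg (0 + 0 + 0) (hstar (@star K A) (hom0 u)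
      (hstar (@star K A) (hom0 v) (hom0 w))) = star u (star v w).
    exact: (@in_degE K A 0).
  by rewrite /= !L !R mulr0 expr0z scale1r.
- by move=> a; apply: one_star.
Qed.

Lemma hbraceE n (a : V) (b : nat -> V) :
  hbrace (@star K A) n (hom0 a) (fun i => hom0 (b i)) = hom0 (brace st n a b).
Proof.
elim: n a b => // n IH a b.
have hstarE (x y : V) : hstar (@star K A) (hom0 x) (hom0 y) = hom0 (st x y).
  by rewrite star0E.
have updE i : (fun j => if j == i then hstar (@star K A) (hom0 (b i)) (hom0 (b n))
    else hom0 (b j)) = (fun j => hom0 (upd b i (st (b i) (b n)) j)).
  by apply/funext => j; rewrite hstarE /upd; case: eqP.
pose m := deg (hom0 a) + \sum_(i < n.+1) deg (hom0 (b i)).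
have m0 : m = 0 by rewrite /m big1 ?addr0.
have -> : hbrace (@star K A) n.+1 (hom0 a) (fun i => hom0 (b i)) = Defs.Hom
    (in_deg m (hstar (@star K A)
       (hbrace (@star K A) n (hom0 a) (fun i => hom0 (b i))) (hom0 (b n)))
     - \sum_(i < n) (-1 : K) ^ (deg (hom0 (b n))
           * \sum_(i.+1 <= j < n) deg (hom0 (b j))) *:
         in_deg m (hbrace (@star K A) n (hom0 a) (fun j =>
           if j == i then hstar (@star K A) (hom0 (b i)) (hom0 (b n))
           else hom0 (b j)))) by [].
under eq_bigr do rewrite updE IH.
rewrite IH hstarE m0.
rewrite in_degE; congr (Defs.Hom (_ - _)); apply: eq_bigr => i _.
by rewrite in_degE mul0r expr0z scale1r.
Qed.

Lemma brace_powE n (a b : V) : brace_pow a b n = brace st n a (fun=> b).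
Proof. by rewrite /brace_pow (hbraceE n a (fun=> b)) in_degE. Qed.

Lemma lie0E : @lie0 K A = st_br st.
Proof.
apply/funext => a; apply/funext => b; rewrite /lie0 /st_br !star0E.
rewrite /hlie; have -> : deg (hom0 a) * deg (hom0 b) = 0 by [].
rewrite expr0z scale1r.
have E x : in_deg 0 (hom0 x) = x by apply: in_degE.
by rewrite -[RHS]E -[X in _ = in_deg _ (Defs.Hom (_ - X))]E.
Qed.

Lemma prelie_expE (l : V) : prelie_exp l = fexp F0 st e l.
Proof. by []. Qed.

Lemma circE (a b : V) : circ a b = fcirc F0 st a b.
Proof.
rewrite /circ /fcirc; congr (fsum _ _); apply/funext => n.
by rewrite brace_powE.
Qed.

Lemma bchE (x y : V) : bch x y = fbch F0 st x y.
Proof. by rewrite /bch /fbch lie0E. Qed.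

End DegreeZero.
Local Open Scope classical_set_scope.

(** * Filtered groups and their topology *)

Section FilteredGroups.
Implicit Types G H : filtered_magma.

Lemma ginvK G (inv : G -> G) : filtered_group_laws inv -> involutive inv.
Proof.
move=> L x; rewrite -[LHS](g_unitr L) -(g_invl L x) (g_assoc L) (g_invl L).
exact: (g_unitl L).
Qed.

(** A conjugate of w is the product of w and of a commutator, which lies deeper
    in the filtration. *)
Lemma gfil_conj G (inv : G -> G) k x w : filtered_group_laws inv -> (0 < k)%N ->
  gfil k w -> gfil k (gmul (gmul (inv x) w) x).
Proof.
move=> L k0 Fw; have Fx : gfil 1 (inv x) by rewrite (gfil_full L).
have := gfil_decr L k0 (gfil_comm L (ltn0Sn 0) k0 Fx Fw).
rewrite (ginvK L) => /(gfil_mul L k0)/(_ Fw).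
by rewrite -(g_assoc L) (g_invl L) (g_unitr L).
Qed.

Lemma transport_filtered_group G H (f : G -> H) (g : H -> G) :
  cancel f g -> cancel g f -> {morph f : x y / gmul x y >-> gmul x y} ->
  f (gunit G) = gunit H ->
  (forall k x, (0 < k)%N -> gfil k x <-> gfil k (f x)) ->
  filtered_group H -> filtered_group G.
Proof.
move=> fK gK fM f1 fF [inv L].
have fI := can_inj fK.
exists (fun x => g (inv (f x))); split.
- by move=> x y z; apply: fI; rewrite !fM (g_assoc L).
- by move=> x; apply: fI; rewrite fM f1 (g_unitl L).
- by move=> x; apply: fI; rewrite fM f1 (g_unitr L).
- by move=> x; apply: fI; rewrite fM gK f1 (g_invl L).
- by move=> x; apply: fI; rewrite fM gK f1 (g_invr L).
- by apply/seteqP; split=> // x _; apply/fF => //; rewrite (gfil_full L).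
- by move=> k k0 x /fF H1; apply/fF => //; apply: (gfil_decr L) => //; apply: H1.
- by move=> k k0; apply/fF => //; rewrite f1; apply: (gfil_unit L).
- move=> k k0 x y /(fF _ _ k0) Fx /(fF _ _ k0) Fy.
  by apply/fF => //; rewrite fM; apply: (gfil_mul L).
- move=> k k0 x /(fF _ _ k0) Fx; apply/fF => //.
  by rewrite gK; apply: (gfil_inv L).
- move=> i j i0 j0 x y /(fF _ _ i0) Fx /(fF _ _ j0) Fy; apply/fF.
    by rewrite addn_gt0 i0.
  by rewrite !fM !gK; apply: (gfil_comm L).
Qed.

(** The topology has the cosets as a subbase, so those that contain x form a
    subbase of neighbourhoods of x. *)
Lemma topo_cvg G (Phi : set_system (topo G)) (x : topo G) : Filter Phi ->
  (forall (y : G) k, (0 < k)%N -> gcoset y k x -> Phi (gcoset y k)) -> Phi --> x.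
Proof.
move=> FPhi PhiP A /=; rewrite (@nbhsE (topo G)) => -[_ [[B sB <-] [C BC Cx] sBA]].
rewrite nbhs_filterE; apply: filterS sBA _; apply: (@filterS _ _ _ C) => [z Cz|]; first by exists C.
have /sB [D sD DC] := BC; rewrite -DC; apply: filter_bigI => E DE.
have := sD _ DE; rewrite inE => -[y [k [k0 EE]]]; rewrite EE; apply: PhiP => //.
by rewrite -EE; move: Cx; rewrite -DC; apply.
Qed.

Lemma nbhs_gcoset G (x : topo G) (y : G) k :
  (0 < k)%N -> gcoset y k x -> nbhs x (gcoset y k).
Proof.
move=> k0 yx; rewrite nbhsE; exists (gcoset y k) => //; split=> //.
exists [set gcoset y k]; last by rewrite bigcup_set1.
move=> _ ->; exists [fset (gcoset y k : set (topo G))]%fset.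
  by move=> E; rewrite inE inE => /eqP ->; exists y, k.
by rewrite set_fset1 bigcap_set1.
Qed.

Lemma gcoset_refl G (inv : G -> G) (x : G) k :
  filtered_group_laws inv -> (0 < k)%N -> gcoset x k x.
Proof.
move=> L k0; exists (gunit G); first exact: (gfil_unit L).
exact: (g_unitr L).
Qed.

Lemma gcoset_preimage G H (f : G -> H) (g : H -> G) :
  cancel f g -> cancel g f -> {morph f : x y / gmul x y >-> gmul x y} ->
  (forall k x, (0 < k)%N -> gfil k x <-> gfil k (f x)) ->
  forall y k, (0 < k)%N -> f @^-1` gcoset y k = gcoset (g y) k.
Proof.
move=> fK gK fM fF y k k0; apply/seteqP; split=> x.
  case=> h Fh E; exists (g h); first by apply/fF; rewrite ?gK.
  by apply: (can_inj fK); rewrite fM !gK.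
by case=> h /(fF _ _ k0) Fh <-; exists (f h) => //; rewrite fM gK.
Qed.

Lemma morph_can G H (f : G -> H) (g : H -> G) : cancel f g -> cancel g f ->
  {morph f : x y / gmul x y >-> gmul x y} ->
  {morph g : x y / gmul x y >-> gmul x y}.
Proof. by move=> fK gK fM x y; apply: (can_inj fK); rewrite fM !gK. Qed.

Lemma filtered_iso_continuous G H (f : G -> H) (g : H -> G) :
  cancel f g -> cancel g f -> {morph f : x y / gmul x y >-> gmul x y} ->
  (forall k x, (0 < k)%N -> gfil k x <-> gfil k (f x)) ->
  continuous (f : topo G -> topo H).
Proof.
move=> fK gK fM fF x; apply: topo_cvg => [|y k k0 yfx].
  by apply: fmap_filter; apply: nbhs_filter.
rewrite /= /fmap /nbhs_simpl /=.
have E := gcoset_preimage fK gK fM fF y k0.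
rewrite [X in nbhs x X]E; apply: nbhs_gcoset => //.
by rewrite -E.
Qed.

End FilteredGroups.

(** * The gauge group and the group of the circle product *)

Section GaugeGroups.
Variables (K : fieldType) (A : complete_unital_dg_prelie K).
Hypothesis charK0 : [pchar K] =i pred0.
Local Notation V := (A 0).
Local Notation F0 := (fun k => @F K A k 0).
Local Notation st := (@star0 K A).
Local Notation e := (Defs.one A).
Local Notation G := (circ_group A).

Let fp := star0_prelie A.
Let fF : filtration F0 := fp_fil fp.
Let cF : fcomplete F0 := @F_complete K A 0.

Lemma sig_eq (T : Type) (P : T -> Prop) (x y : {z : T | P z}) :
  sval x = sval y -> x = y.
Proof.
case: x y => [x Px] [y Py] /= E; subst y; congr exist.
exact: Prop_irrelevance.
Qed.

Let circ_eq (x y : G) : sval x = sval y -> x = y.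
Proof. exact: sig_eq. Qed.

Lemma circ_mulE (x y : G) : sval (gmul x y) = fcirc F0 st (sval x) (sval y - e).
Proof. exact: circE. Qed.

Let Fbch (x y : V) : F0 1 x -> F0 1 y -> F0 1 (fbch F0 st x y).
Proof. by move=> Fx Fy; rewrite -bchE; apply: fil_bch. Qed.

Lemma circ_unitl : left_id (gunit G) (@gmul G).
Proof.
move=> x; apply: circ_eq; rewrite circ_mulE (fcirc_unit charK0 fp cF) ?subrKC //.
exact: (svalP x).
Qed.

Lemma circ_unitr : right_id (gunit G) (@gmul G).
Proof.
by move=> x; apply: circ_eq; rewrite circ_mulE /= subrr (fcirc0 fp cF).
Qed.

Lemma circ_assoc : associative (@gmul G).
Proof.
move=> x y z; apply: circ_eq; rewrite !circ_mulE.
rewrite (fcircA charK0 fp cF _ Fbch (svalP y) (svalP z)).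
by rewrite subrKC.
Qed.

Lemma circ_invl k (x : G) : F0 1 (sval x - e) -> (0 < k)%N -> gfil k x ->
  exists2 y : G, gfil k y & gmul y x = gunit G.
Proof.
move=> Fx k0 Fk; have [a [Fa Fka aE]] := fcirc_inv charK0 fp cF Fx Fk.
have Fy : F0 1 (e + a - e) by rewrite addrAC subrr add0r.
exists (exist _ (e + a) Fy : G); first by rewrite /= addrAC subrr add0r.
by apply: circ_eq; rewrite circ_mulE.
Qed.

(** The terms that involve both a and b lie in F_(i+j). As e + a + b is
    symmetric in a and b, this controls commutators. *)
Lemma fcirc_addF i j (a b : V) : F0 1 a -> F0 1 b -> F0 i a -> F0 j b ->
  F0 (i + j)%N (fcirc F0 st (e + a) b - (e + a + b)).
Proof.
move=> Fa Fb Fi Fj; have -> : e + a = e - - a by rewrite opprK.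
rewrite (fcircB charK0 fp cF) // (fcirc_unit charK0 fp cF) //.
have -> : e + b - fcirc F0 st (- a) b - (e - - a + b)
    = - (fcirc F0 st (- a) b - - a).
  by rewrite opprB [e - - a + b]addrAC opprD opprK addrACA subrr add0r addrC.
by apply/(filN fF)/(fcirc_fil fp cF) => //; apply: (filN fF).
Qed.

Lemma circ_comm_fil i j (x y : G) : (0 < i)%N -> (0 < j)%N ->
  gfil i x -> gfil j y -> F0 (i + j)%N (sval (gmul x y) - sval (gmul y x)).
Proof.
move=> i0 j0 Fi Fj; have Fx := svalP x; have Fy := svalP y; rewrite !circ_mulE.
have E (u v : G) : sval u = e + (sval u - e) by rewrite subrKC.
rewrite {1}(E x x) [X in _ - fcirc _ _ X _](E y y).
have := filB fF (fcirc_addF Fx Fy Fi Fj).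
have := fcirc_addF Fy Fx Fj Fi; rewrite addnC (addrAC e (sval y - e)) => H /(_ _ H).
by rewrite opprB addrA subrK.
Qed.

Lemma circ_filtered_group : filtered_group G.
Proof.
have /choice [inv invP] (x : G) : exists y : G, gmul y x = gunit G.
  have [|y _ yx] := @circ_invl 1 x (svalP x) isT; first exact: (svalP x).
  by exists y.
have invr (x : G) : gmul x (inv x) = gunit G.
  rewrite -[gmul x _]circ_unitl -{1}(invP (inv x)) -circ_assoc.
  by rewrite [gmul (inv x) _]circ_assoc invP circ_unitl invP.
exists inv; split=> //.
- exact: circ_assoc.
- exact: circ_unitl.
- exact: circ_unitr.
- by apply/seteqP; split=> // x _; apply: (svalP x).
- by move=> k _ x; apply: (fil_decr fF).
- by move=> k _; rewrite /= subrr; apply: (fil0 fF).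
- move=> k k0 x y Fx Fy; rewrite -[gfil _ _]/(F0 k (sval (gmul x y) - e)).
  rewrite circ_mulE -(subrKA (sval x)); apply: (filD fF) => //.
  rewrite -[k]add0n; apply: (fcirc_fil fp cF) => //.
    exact: (filT fF).
  exact: (svalP y).
- move=> k k0 x Fx; have [y Fy yx] := circ_invl (svalP x) k0 Fx.
  suff -> : inv x = y by [].
  by rewrite -[inv x]circ_unitl -yx -circ_assoc invr circ_unitr.
move=> i j i0 j0 x y Fx Fy.
(* The commutator is u w with w inverse to v; by linearity of the product on the
   left, u w - v w is as small as u - v. *)
set u := gmul x y; set v := gmul y x; set w := gmul (inv x) (inv y).
have vw : gmul v w = gunit G.
  by rewrite /v /w -circ_assoc [gmul x _]circ_assoc invr circ_unitl invr.
rewrite -circ_assoc -/w -/u.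
rewrite -[gfil _ _]/(F0 (i + j)%N (sval (gmul u w) - sval (gunit G))) -vw.
rewrite (circ_mulE u w) (circ_mulE v w) -(fcircB charK0 fp cF); last exact: (svalP w).
apply: (fil_fcirc fp cF); last exact: (svalP w).
exact: circ_comm_fil.
Qed.

(** The product is linear on the left only: the quotient that is easy to bound is
    z x^-1 = 1 + (z - x) x^-1, and x^-1 z is one of its conjugates. *)
Lemma circ_gcoset (x z : G) k : (0 < k)%N ->
  gcoset x k z <-> F0 k (sval z - sval x).
Proof.
move=> k0; split.
  case=> h Fh <-; rewrite circ_mulE -[k]add0n.
  apply: (fcirc_fil fp cF) => //; first exact: (filT fF).
  exact: (svalP h).
have [inv L] := circ_filtered_group; move=> Fzx.
exists (gmul (gmul (inv x) (gmul z (inv x))) x).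
  apply: (gfil_conj _ L) => //.
  rewrite -[gfil _ _]/(F0 k (sval (gmul z (inv x)) - sval (gunit G))).
  rewrite -(g_invr L x) (circ_mulE z) (circ_mulE x) -(fcircB charK0 fp cF).
    by apply: (fil_fcirc fp cF) => //; apply: (svalP (inv x)).
  exact: (svalP (inv x)).
rewrite -(g_assoc L) -(g_assoc L z) (g_invl L) (g_unitr L) (g_assoc L).
by rewrite (g_invr L) (g_unitl L).
Qed.

Lemma circ_hausdorff : hausdorff_space (topo G).
Proof.
have [inv L] := circ_filtered_group.
move=> p q pq; apply: circ_eq; apply: (cong_eq fF cF) => -[|k]; first exact: (filT fF).
have nb (x : topo G) : nbhs x (gcoset (x : G) k.+1).
  by apply: nbhs_gcoset => //; apply: (gcoset_refl x L).
have [z [zp zq]] := pq _ _ (nb p) (nb q).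
apply: (cong_trans fF (y := sval (z : G))); last exact/circ_gcoset.
by apply: (cong_sym fF); apply/circ_gcoset.
Qed.

Lemma circ_cauchy_complete : cauchy_complete G.
Proof.
move=> Phi PF PhiP.
have /choice [x xP] k : exists x : G, Phi (gcoset x k.+1) by apply: PhiP.
have xS k : F0 k.+1 (sval (x k.+1) - sval (x k)).
  have [y [/circ_gcoset yk /circ_gcoset yl]] := filter_ex (filterI (xP k) (xP k.+1)).
  apply: (cong_trans fF (y := sval y)); last exact: yk.
  exact/(cong_sym fF)/(fil_decr fF)/yl.
pose u n : V := if n is k.+1 then sval (x k) else 0.
have [|v [vE _]] := cF (c := fun k => fcoset F0 k (u k)).
  split=> [k|k z]; first by exists (u k).
  rewrite /fcoset /= => Fz; case: k Fz => [|k] Fz; first exact: (filT fF).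
  exact: (cong_trans fF (fil_decr fF Fz) (xS k)).
have vx k : F0 k.+1 (v - sval (x k)).
  have := congr1 (@^~ k.+1) vE; rewrite /fcoset => /= /seteqP [+ _].
  by apply; rewrite /= subrr; apply: (fil0 fF).
have Fv : F0 1 (v - e).
  by apply: (cong_trans fF (vx 0%N)); apply: (svalP (x 0%N)).
exists (exist _ v Fv : G); apply: topo_cvg => y k k0 /circ_gcoset => /(_ k0) yv.
case: k k0 yv => // k _ yv; apply: filterS (xP k) => z /circ_gcoset zx.
apply/circ_gcoset => //; apply: (cong_trans fF (zx isT)).
exact: (cong_trans fF (cong_sym fF (vx k)) yv).
Qed.

Lemma circ_complete_group : complete_group G.
Proof.
split; [exact: circ_filtered_group | exact: circ_hausdorff |].
exact: circ_cauchy_complete.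
Qed.

Local Notation Gamma := (gauge_group A).
Local Notation exp := (@exp_map K A).

Lemma exp_map_morph : {morph exp : x y / gmul x y >-> gmul x y}.
Proof.
move=> x y; apply: circ_eq; rewrite circ_mulE /= !prelie_expE bchE.
apply/esym/(fexp_fbch charK0 fp cF (svalP x) (svalP y)).
exact: Fbch (svalP x) (svalP y).
Qed.

Let fexp0 : fexp F0 st e 0 = e.
Proof.
apply: (cong_eq fF cF) => k.
by apply: (fil_fexp fp cF); apply: (fil0 fF).
Qed.

Lemma exp_map_fil k (l : Gamma) : gfil k l <-> gfil k (exp l).
Proof.
have F1 := svalP l; rewrite -[gfil _ _]/(F0 k (sval l)).
rewrite -[gfil _ (exp l)]/(F0 k (prelie_exp (sval l) - e)) prelie_expE.
split=> [|Fk]; first exact: (fil_fexp fp cF).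
rewrite -[sval l]subr0; apply: (fexp_fil fp cF) => //; first exact: (fil0 fF).
by rewrite fexp0.
Qed.

Lemma exp_map_bij : exists g : G -> Gamma, cancel exp g /\ cancel g exp.
Proof.
have expI : injective exp.
  move=> x y /(congr1 sval) /= E; apply: (@sig_eq _ _ x y).
  apply: (cong_eq fF cF) => k; apply: (fexp_fil fp cF (svalP x) (svalP y)).
  by rewrite -!prelie_expE E subrr; apply: (fil0 fF).
have /choice [g gK] (b : G) : exists l : Gamma, exp l = b.
  have [l Fl lE] := fexp_surj fp cF (svalP b).
  exists (exist _ l Fl : Gamma); apply: circ_eq => /=.
  by rewrite prelie_expE -[LHS](subrK e) lE subrK.
by exists g; split=> // x; apply: expI; rewrite gK.
Qed.

Lemma gauge_filtered_group : filtered_group Gamma.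
Proof.
have [g [fK gK]] := exp_map_bij.
apply: (transport_filtered_group fK gK exp_map_morph) => //.
- by apply: circ_eq; rewrite /= prelie_expE fexp0.
- by move=> k x _; apply: exp_map_fil.
exact: circ_filtered_group.
Qed.

End GaugeGroups.

Theorem theorem3p16 (K : fieldType) (charK0 : [pchar K] =i pred0)
    (A : complete_unital_dg_prelie K) :
  [/\ complete_group (circ_group A),
      filtered_iso (@exp_map K A)
    & homeomorphism (@exp_map K A : topo (gauge_group A) -> topo (circ_group A))].
Proof.
have [g [fK gK]] := exp_map_bij A.
have fM := @exp_map_morph K A charK0.
have fF k x : (0 < k)%N -> gfil k x <-> gfil k (@exp_map K A x).
  by move=> _; apply: exp_map_fil.
have gF k x : (0 < k)%N -> gfil k x <-> gfil k (g x).
  by move=> k0; rewrite -{1}[x]gK; split=> /(fF _ _ k0).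
split; first exact: circ_complete_group.
  split=> //; [exact: gauge_filtered_group | exact: circ_filtered_group |].
  by exists g; split=> // k x k0 Fx; [apply/fF | apply/gF].
exists g; split=> //; first exact: (filtered_iso_continuous fK gK fM fF).
exact: (filtered_iso_continuous gK fK (morph_can fK gK fM) gF).
Qed.
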